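(* Let $F$ be a field of characteristic $0$, let $\mathfrak{g}$ be a finite-dimensional central simple Lie algebra over $F$ and let $A$ be a reduced unital associative commutative $F$-algebra. Equip $\mathfrak{g}\otimes A$ with the Lie bracket $[a\otimes f,b\otimes g]=[a,b]\otimes fg$. Let $L$ be a Lie algebra over $F$ equipped with a non-degenerate symmetric invariant bilinear form $B$ such that $\mathfrak{g}\otimes A\subseteq L$ is a coisotropic subalgebra. Then, as a $\mathfrak{g}$-module, $L\cong\mathfrak{g}\otimes\widetilde A$ for a unital associative commutative algebra extension $\widetilde A\supseteq A$.
   Context: A finite-dimensional algebra $\mathfrak{a}$ over $F$ is central if its centroid $\{f\in\mathrm{End}_F(\mathfrak{a})\mid af(b)=f(ab)=f(a)b\ \forall a,b\in\mathfrak{a}\}$ consists only of scalar multiples of the identity. A subalgebra $S\subseteq L$ is coisotropic if $S^\perp\subseteq S$ with respect to $B$. $L$ is a $\mathfrak{g}$-module via $\mathfrak{g}\cong\mathfrak{g}\otimes1\subseteq\mathfrak{g}\otimes A\subseteq L$ and the adjoint action; $\mathfrak{g}$ acts on the first factor of $\mathfrak{g}\otimes\widetilde A$ by the adjoint action. *)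

(* Defs.v *)
From HB Require Import structures.
From mathcomp Require Import all_boot all_order all_algebra.
From mathcomp Require Import boolp classical_sets.

Set Implicit Arguments.
Unset Strict Implicit.
Unset Printing Implicit Defensive.

Import GRing.Theory.

Local Open Scope quotient_scope.
Local Open Scope ring_scope.

Section BilinearFor.
Variables (F : fieldType) (V W U : lmodType F) (f : V -> W -> U).
Hypothesis f_bil : bilinear_for *:%R *:%R f.

Lemma bilDl w v v' : f (v + v') w = f v w + f v' w.
Proof. by have := f_bil.1 w 1 v v'; rewrite /= !scale1r. Qed.

Lemma bilDr v w w' : f v (w + w') = f v w + f v w'.
Proof. by have := f_bil.2 v 1 w w'; rewrite /= !scale1r. Qed.

Lemma bil0l w : f 0 w = 0.
Proof. by apply: (addrI (f 0 w)); rewrite -bilDl !addr0. Qed.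

Lemma bil0r v : f v 0 = 0.
Proof. by apply: (addrI (f v 0)); rewrite -bilDr !addr0. Qed.

Lemma bilZl c v w : f (c *: v) w = c *: f v w.
Proof. by have := f_bil.1 w c v 0; rewrite /= !addr0 bil0l addr0. Qed.

Lemma bilZr c v w : f v (c *: w) = c *: f v w.
Proof. by have := f_bil.2 v c w 0; rewrite /= !addr0 bil0r addr0. Qed.

End BilinearFor.

(* A list of pairs [:: (v1, w1); ...; (vn, wn)] stands for the formal sum of
   the v_i (x) w_i; [tensor V W] is the quotient of these formal sums by the
   least congruence containing the relations of the tensor product.  See
   [tlift_linear], [tliftE] and [tlift_unique] for the universal property. *)

Section Tensor.
Variables (F : fieldType) (V W : lmodType F).
Implicit Types (s t u : seq (V * W)) (v : V) (w : W).

Inductive tensor_rel : seq (V * W) -> seq (V * W) -> Prop :=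
| trel_refl s : tensor_rel s s
| trel_sym s t : tensor_rel s t -> tensor_rel t s
| trel_trans s t u : tensor_rel s t -> tensor_rel t u -> tensor_rel s u
| trel_cat s s' t t' :
    tensor_rel s s' -> tensor_rel t t' -> tensor_rel (s ++ t) (s' ++ t')
| trel_catC s t : tensor_rel (s ++ t) (t ++ s)
| trel_0 w : tensor_rel [:: (0, w)] [::]
| trel_Dl v v' w : tensor_rel [:: (v + v', w)] [:: (v, w); (v', w)]
| trel_Dr v w w' : tensor_rel [:: (v, w + w')] [:: (v, w); (v, w')]
| trel_Z (c : F) v w : tensor_rel [:: (c *: v, w)] [:: (v, c *: w)].

Definition tensor_relb s t : bool := `[< tensor_rel s t >].

Lemma tensor_relb_refl : reflexive tensor_relb.
Proof. by move=> s; apply/asboolP; apply: trel_refl. Qed.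

Lemma tensor_relb_sym : symmetric tensor_relb.
Proof. by move=> s t; apply/asboolP/asboolP; apply: trel_sym. Qed.

Lemma tensor_relb_trans : transitive tensor_relb.
Proof.
by move=> t s u /asboolP st /asboolP tu; apply/asboolP; apply: trel_trans st tu.
Qed.

Canonical tensor_equiv :=
  EquivRel tensor_relb tensor_relb_refl tensor_relb_sym tensor_relb_trans.

Definition tensor : Type := {eq_quot tensor_equiv}.

HB.instance Definition _ := Choice.on tensor.
HB.instance Definition _ := EqQuotient.on tensor.

Definition tclass s : tensor := \pi_tensor s.

Lemma tclassP s t : tclass s = tclass t <-> tensor_rel s t.
Proof.
split; first by move/eqmodP/asboolP.
by move=> st; apply/eqmodP/asboolP.
Qed.

Lemma tclassK (x : tensor) : tclass (repr x) = x.
Proof. exact: reprK. Qed.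

Lemma trel_repr s : tensor_rel (repr (tclass s)) s.
Proof. by apply/tclassP; rewrite tclassK. Qed.

Definition tscale_seq (c : F) s := [seq (c *: p.1, p.2) | p <- s].

Lemma trel_cons0 s : tensor_rel (tscale_seq 0 s) [::].
Proof.
elim: s => [|[v w] s IHs]; first exact: trel_refl.
rewrite /= scale0r -cat1s -[X in tensor_rel _ X]cat0s.
by apply: trel_cat IHs; apply: trel_0.
Qed.

Lemma trel_scale c s t :
  tensor_rel s t -> tensor_rel (tscale_seq c s) (tscale_seq c t).
Proof.
elim=> {s t}.
- by move=> s; apply: trel_refl.
- by move=> s t _; apply: trel_sym.
- by move=> s t u _ st _ tu; apply: trel_trans st tu.
- by move=> s s' t t' _ ss' _ tt'; rewrite /tscale_seq !map_cat; apply: trel_cat.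
- by move=> s t; rewrite /tscale_seq !map_cat; apply: trel_catC.
- by move=> w; rewrite /= scaler0; apply: trel_0.
- by move=> v v' w; rewrite /= scalerDr; apply: trel_Dl.
- move=> v w w' /=; apply: trel_Dr.
- by move=> a v w /=; rewrite scalerA mulrC -scalerA; apply: trel_Z.
Qed.

Lemma trel_scaleD a b s :
  tensor_rel (tscale_seq (a + b) s) (tscale_seq a s ++ tscale_seq b s).
Proof.
elim: s => [|[v w] s IHs] /=; first exact: trel_refl.
rewrite scalerDl -cat1s -[X in tensor_rel _ X]cat1s.
apply: trel_trans (trel_cat (trel_Dl _ _ _) IHs) _.
rewrite -[_ :: _ :: _]/([:: _] ++ [:: _]) -!catA /=.
rewrite -cat1s -[X in tensor_rel _ X]cat1s.
apply: trel_cat; first exact: trel_refl.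
rewrite -cat1s -[X in tensor_rel _ (_ ++ X)]cat1s !catA.
by apply: trel_cat; [exact: trel_catC | exact: trel_refl].
Qed.

Definition tzero : tensor := tclass [::].
Definition tadd (x y : tensor) : tensor := tclass (repr x ++ repr y).
Definition tscale (c : F) (x : tensor) : tensor := tclass (tscale_seq c (repr x)).
Definition topp (x : tensor) : tensor := tscale (-1) x.

Lemma tadd_class s t : tadd (tclass s) (tclass t) = tclass (s ++ t).
Proof. by apply/tclassP; apply: trel_cat; apply: trel_repr. Qed.

Lemma tscale_class c s : tscale c (tclass s) = tclass (tscale_seq c s).
Proof. by apply/tclassP; apply: trel_scale; apply: trel_repr. Qed.

Lemma taddA : associative tadd.
Proof.
move=> x y z; rewrite -(tclassK x) -(tclassK y) -(tclassK z).
by rewrite !tadd_class catA.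
Qed.

Lemma taddC : commutative tadd.
Proof.
move=> x y; rewrite -(tclassK x) -(tclassK y) !tadd_class.
by apply/tclassP; apply: trel_catC.
Qed.

Lemma tadd0 : left_id tzero tadd.
Proof. by move=> x; rewrite -(tclassK x) tadd_class. Qed.

Lemma tscale1 x : tscale 1 x = x.
Proof.
rewrite -(tclassK x) tscale_class; congr tclass.
by rewrite /tscale_seq -[RHS]map_id; apply: eq_map => -[v w] /=; rewrite scale1r.
Qed.

Lemma tscaleDl x a b : tscale (a + b) x = tadd (tscale a x) (tscale b x).
Proof.
rewrite -(tclassK x) !tscale_class tadd_class.
by apply/tclassP; apply: trel_scaleD.
Qed.

Lemma taddN : left_inverse tzero topp tadd.
Proof.
move=> x; rewrite /topp -{2}(tscale1 x) -tscaleDl addNr.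
by rewrite -(tclassK x) tscale_class; apply/tclassP; apply: trel_cons0.
Qed.

HB.instance Definition _ :=
  GRing.isZmodule.Build tensor taddA taddC tadd0 taddN.

Lemma tscaleA a b x : tscale a (tscale b x) = tscale (a * b) x.
Proof.
rewrite -(tclassK x) !tscale_class; congr tclass.
by rewrite /tscale_seq -map_comp; apply: eq_map => -[v w] /=; rewrite scalerA.
Qed.

Lemma tscaleDr a : {morph tscale a : x y / x + y}.
Proof.
move=> x y; rewrite -(tclassK x) -(tclassK y).
rewrite [_ + _]tadd_class !tscale_class [RHS]tadd_class.
by rewrite /tscale_seq map_cat.
Qed.

HB.instance Definition _ := GRing.Zmodule_isLmodule.Build F tensor
  tscaleA tscale1 tscaleDr tscaleDl.

Definition tens v w : tensor := tclass [:: (v, w)].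

Lemma tensDl v v' w : tens (v + v') w = tens v w + tens v' w.
Proof. by rewrite [RHS]tadd_class; apply/tclassP; apply: trel_Dl. Qed.

Lemma tensDr v w w' : tens v (w + w') = tens v w + tens v w'.
Proof. by rewrite [RHS]tadd_class; apply/tclassP; apply: trel_Dr. Qed.

Lemma tensZl c v w : tens (c *: v) w = c *: tens v w.
Proof. by rewrite [RHS]tscale_class. Qed.

Lemma tensZr c v w : tens v (c *: w) = c *: tens v w.
Proof. by rewrite -tensZl; apply/esym/tclassP; apply: trel_Z. Qed.

Lemma tens_is_bilinear :
  bilinear_for *:%R *:%R (tens : V -> W -> tensor).
Proof.
by split=> [w c v v' | v c w w'] /=; rewrite ?tensDl ?tensDr ?tensZl ?tensZr.
Qed.

HB.instance Definition _ :=
  bilinear_isBilinear.Build F V W tensor *:%R *:%R tens tens_is_bilinear.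

Lemma tclass_sum s : tclass s = \sum_(p <- s) tens p.1 p.2.
Proof.
elim: s => [|[v w] s IHs]; first by rewrite big_nil.
by rewrite big_cons -IHs [RHS]tadd_class.
Qed.

Lemma tensorP (x : tensor) : exists s, x = \sum_(p <- s) tens p.1 p.2.
Proof. by exists (repr x); rewrite -tclass_sum tclassK. Qed.

Lemma tensor_ind (P : tensor -> Prop) :
  P 0 -> (forall x y, P x -> P y -> P (x + y)) ->
  (forall v w, P (tens v w)) -> forall x, P x.
Proof. by move=> P0 PD Pt x; have [s ->] := tensorP x; apply: big_ind. Qed.

Definition tlift (U : lmodType F) (f : V -> W -> U) (x : tensor) : U :=
  \sum_(p <- repr x) f p.1 p.2.

Section Lift.
Variables (U : lmodType F) (f : V -> W -> U).
Hypothesis f_bil : bilinear_for *:%R *:%R f.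

Let trel_sum s t : tensor_rel s t ->
  \sum_(p <- s) f p.1 p.2 = \sum_(p <- t) f p.1 p.2.
Proof.
elim=> {s t} //.
- by move=> s t u _ -> _ ->.
- by move=> s s' t t' _ ss' _ tt'; rewrite !big_cat /= ss' tt'.
- by move=> s t; rewrite !big_cat /= addrC.
- by move=> w; rewrite big_cons !big_nil /= (bil0l f_bil) addr0.
- by move=> v v' w; rewrite !big_cons !big_nil /= (bilDl f_bil) !addr0.
- by move=> v w w'; rewrite !big_cons !big_nil /= (bilDr f_bil) !addr0.
- by move=> c v w; rewrite !big_cons !big_nil /= (bilZl f_bil) (bilZr f_bil).
Qed.

Let tlift_class s : tlift f (tclass s) = \sum_(p <- s) f p.1 p.2.
Proof. exact: trel_sum (trel_repr s). Qed.

Lemma tliftE v w : tlift f (tens v w) = f v w.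
Proof. by rewrite tlift_class big_cons big_nil addr0. Qed.

Lemma tlift_linear : linear (tlift f).
Proof.
move=> c x y; rewrite -(tclassK x) -(tclassK y).
rewrite [c *: _]tscale_class [_ + _]tadd_class !tlift_class big_cat /=.
by rewrite big_map scaler_sumr; congr (_ + _); apply: eq_bigr => p _; rewrite (bilZl f_bil).
Qed.

Lemma tlift_unique (h : {linear tensor -> U}) :
  (forall v w, h (tens v w) = f v w) -> h =1 tlift f.
Proof.
move=> hE x; rewrite -(tclassK x) tlift_class tclass_sum linear_sum.
by apply: eq_bigr => p _; rewrite hE.
Qed.

End Lift.

End Tensor.

Arguments tens {F V W} v w.

HB.mixin Record Lmodule_isLieAlgebra (F : fieldType) L of GRing.Lmodule F L := {
  lie : L -> L -> L;
  lie_is_bilinear : bilinear_for *:%R *:%R lie;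
  liexx : forall x, lie x x = 0;
  jacobi : forall x y z,
    lie x (lie y z) + lie y (lie z x) + lie z (lie x y) = 0
}.

#[short(type="lieAlgType")]
HB.structure Definition LieAlgebra (F : fieldType) :=
  { L of Lmodule_isLieAlgebra F L & GRing.Lmodule F L }.

#[short(type="finLieAlgType")]
HB.structure Definition FinLieAlgebra (F : fieldType) :=
  { L of LieAlgebra F L & Vector F L }.

Section LieTheory.
Variables (F : fieldType) (L : lieAlgType F).

HB.instance Definition _ := bilinear_isBilinear.Build F L L L *:%R *:%R
  (lie : L -> L -> L) lie_is_bilinear.

Lemma lieC (x y : L) : lie x y = - lie y x.
Proof.
apply/eqP; rewrite -addr_eq0; apply/eqP.
by have := liexx (x + y); rewrite linearDl !linearDr /= !liexx add0r addr0.
Qed.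

End LieTheory.

Section CentralSimple.
Variables (F : fieldType) (g : finLieAlgType F).

Definition lie_ideal (I : {vspace g}) : Prop :=
  forall x y : g, y \in I -> lie x y \in I.

Definition simple_lie : Prop :=
  (exists x y : g, lie x y != 0) /\
  (forall I : {vspace g}, lie_ideal I -> I = 0%VS \/ I = fullv).

Definition in_centroid (f : 'End(g)) : Prop :=
  forall a b : g, lie a (f b) = f (lie a b) /\ f (lie a b) = lie (f a) b.

Definition central_lie : Prop :=
  forall f : 'End(g), in_centroid f -> exists c : F, f = c *: \1%VF.

End CentralSimple.

Definition reduced_ring (A : nzRingType) : Prop :=
  forall (a : A) (n : nat), a ^+ n = 0 -> a = 0.

Section CurrentAlgebra.
Variables (F : fieldType) (g : lieAlgType F) (A : comAlgType F).

Definition tlie_pure (a : g) (f : A) : tensor g A -> tensor g A :=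
  tlift (fun (b : g) (h : A) => tens (lie a b) (f * h)).

Definition tlie (s t : tensor g A) : tensor g A :=
  tlift (fun (a : g) (f : A) => tlie_pure a f t) s.

Let tlie_pure_bil a f :
  bilinear_for *:%R *:%R (fun (b : g) (h : A) => tens (lie a b) (f * h)).
Proof.
split=> [h c b b' | b c h h'] /=.
  by rewrite linearDr linearZr /= tensDl tensZl.
by rewrite mulrDr -scalerAr tensDr tensZr.
Qed.

Let tlie_pureE a f b h : tlie_pure a f (tens b h) = tens (lie a b) (f * h).
Proof. exact: tliftE (tlie_pure_bil a f) b h. Qed.

Let tlie_pure_linear a f : linear (tlie_pure a f).
Proof. exact: tlift_linear (tlie_pure_bil a f). Qed.

HB.instance Definition _ a f := GRing.isLinear.Build F (tensor g A) (tensor g A)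
  *:%R (tlie_pure a f) (tlie_pure_linear a f).

Let tlie_pureD a f x y :
  tlie_pure a f (x + y) = tlie_pure a f x + tlie_pure a f y.
Proof. exact: linearD. Qed.

Let tlie_bil_l t : bilinear_for *:%R *:%R (fun a f => tlie_pure a f t).
Proof.
split=> [f c a a' | a c f f'] /=; elim/(@tensor_ind F g A): t => [|x y Hx Hy|b h].
- by rewrite !linear0 addr0.
- by rewrite !tlie_pureD Hx Hy scalerDr addrACA.
- by rewrite !tlie_pureE linearDl linearZl_LR /= tensDl tensZl.
- by rewrite !linear0 addr0.
- by rewrite !tlie_pureD Hx Hy scalerDr addrACA.
- by rewrite !tlie_pureE mulrDl -scalerAl tensDr tensZr.
Qed.

Lemma tlieE a f b h :
  tlie (tens a f) (tens b h) = tens (lie a b) (f * h).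
Proof. by rewrite /tlie (tliftE (tlie_bil_l _)) tlie_pureE. Qed.

Lemma tlie_is_bilinear : bilinear_for *:%R *:%R tlie.
Proof.
split=> [t | s]; first exact: tlift_linear (tlie_bil_l t).
move=> c x y; rewrite /tlie /tlift /= scaler_sumr -big_split /=.
by apply: eq_bigr => p _; rewrite linearP.
Qed.

Let tlieDl t x y : tlie (x + y) t = tlie x t + tlie y t.
Proof. exact: bilDl tlie_is_bilinear _ _ _. Qed.
Let tlieDr t x y : tlie t (x + y) = tlie t x + tlie t y.
Proof. exact: bilDr tlie_is_bilinear _ _ _. Qed.
Let tlie0l t : tlie 0 t = 0.
Proof. exact: bil0l tlie_is_bilinear _. Qed.
Let tlie0r t : tlie t 0 = 0.
Proof. exact: bil0r tlie_is_bilinear _. Qed.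

Let tlieC x y : tlie x y + tlie y x = 0.
Proof.
elim/(@tensor_ind F g A): x => [|x x' Hx Hx'|a f].
- by rewrite tlie0l tlie0r addr0.
- by rewrite tlieDl tlieDr addrACA Hx Hx' addr0.
elim/(@tensor_ind F g A): y => [|y y' Hy Hy'|b h].
- by rewrite tlie0l tlie0r addr0.
- by rewrite tlieDl tlieDr addrACA Hy Hy' addr0.
by rewrite !tlieE [h * f]mulrC -tensDl [lie b a]lieC subrr linear0l.
Qed.

Lemma tliexx x : tlie x x = 0.
Proof.
elim/(@tensor_ind F g A): x => [|x y Hx Hy|a f].
- by rewrite tlie0l.
- by rewrite tlieDl !tlieDr Hx Hy add0r addr0 tlieC.
- by rewrite tlieE liexx linear0l.
Qed.

Let add3ACA (a a' b b' c c' : tensor g A) :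
  a + a' + (b + b') + (c + c') = (a + b + c) + (a' + b' + c').
Proof. by rewrite (addrACA a a') (addrACA (a + b)). Qed.

Lemma tjacobi x y z :
  tlie x (tlie y z) + tlie y (tlie z x) + tlie z (tlie x y) = 0.
Proof.
elim/(@tensor_ind F g A): x => [|x x' Hx Hx'|a f].
- by rewrite !(tlie0l, tlie0r) !addr0.
- by rewrite !(tlieDl, tlieDr) add3ACA Hx Hx' addr0.
elim/(@tensor_ind F g A): y => [|y y' Hy Hy'|b h].
- by rewrite !(tlie0l, tlie0r) !addr0.
- by rewrite !(tlieDl, tlieDr) add3ACA Hy Hy' addr0.
elim/(@tensor_ind F g A): z => [|z z' Hz Hz'|c k].
- by rewrite !(tlie0l, tlie0r) !addr0.
- by rewrite !(tlieDl, tlieDr) add3ACA Hz Hz' addr0.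
rewrite !tlieE [h * (k * f)]mulrA [h * k * f]mulrC.
by rewrite [k * (f * h)]mulrC -[f * h * k]mulrA -!tensDl jacobi linear0l.
Qed.

HB.instance Definition _ := Lmodule_isLieAlgebra.Build F (tensor g A)
  tlie_is_bilinear tliexx tjacobi.

Lemma lie_tens (a b : g) (f h : A) :
  lie (tens a f : tensor g A) (tens b h) = tens (lie a b) (f * h).
Proof. exact: tlieE. Qed.

(* The operator ad x (x) id. *)
Definition tensor_act (x : g) : tensor g A -> tensor g A :=
  tlift (fun (y : g) (a : A) => tens (lie x y) a).

Lemma tensor_actE x y a : tensor_act x (tens y a) = tens (lie x y) a.
Proof.
apply: (@tliftE F g A _ (fun y a => tens (lie x y) a)).
split=> [b c z z' | z c b b'] /=.
  by rewrite linearDr linearZr /= tensDl tensZl.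
by rewrite tensDr tensZr.
Qed.

End CurrentAlgebra.

Section Forms.
Variables (F : fieldType) (L : lieAlgType F) (B : {biscalar L}).

Definition form_symmetric : Prop := forall x y : L, B x y = B y x.

Definition form_nondegenerate : Prop :=
  forall x : L, (forall y : L, B x y = 0) -> x = 0.

Definition form_invariant : Prop :=
  forall x y z : L, B (lie x y) z = B x (lie y z).

Definition form_orthogonal (S : set L) : set L :=
  [set x | forall y, S y -> B x y = 0].

Definition coisotropic (S : set L) : Prop :=
  (form_orthogonal S `<=` S)%classic.

End Forms.

(* Main.v *)
(* Put [M = g (x) A] and let [M^perp] be its orthogonal in [L].  As [M^perp] lies
   in [M], it suffices to control [M] and [L / M^perp], and the latter embeds
   into [Hom(g (x) A, F) = g (x) A^*] through [B] and the Killing form.  There is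
   a polynomial [p] with [p(0) = 1] such that [p(C)], for [C] the Casimir operator
   of [End g], is the projection [T |-> (tr T / dim g) id].  The same polynomial
   in the Casimir operator of [Hom(g, L)], applied twice, is then a projection
   onto [V = Hom_g(g, L)], and the evaluation [g (x) V -> L] is an isomorphism.
   Now [V] contains [A] through [a |-> (x |-> x (x) a)], and [V / A] is an
   [A]-module: modulo [Hom(g, M^perp)], [V] is an [A]-submodule of [A^*].  One
   takes for [At] the square-zero extension of [A] by [V / A].

   The polynomial [p] comes from Whitehead's argument: on the nilpotent part of
   the Casimir operator of a representation the trace form, a multiple of the
   Killing form because [g] is central simple, vanishes, so that [g] acts
   trivially there by Cartan's criterion. *)

Require Import Defs.
From HB Require Import structures.
From mathcomp Require Import all_boot all_order all_algebra fieldext.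
From mathcomp Require Import boolp classical_sets.
From mathcomp Require Import ring.

Set Implicit Arguments.
Unset Strict Implicit.
Unset Printing Implicit Defensive.

Import Order.TTheory GRing.Theory Num.Theory VectorInternalTheory.
Local Open Scope ring_scope.

(** * Splitting fields and traces *)

(** [L] is an arbitrary [g]-module, possibly infinite dimensional, over a field that need not be
    algebraically closed, so neither complete reducibility nor weights are at hand. A polynomial in
    the Casimir operator makes sense on every module and commutes with equivariant maps; an identity
    proved in the finite-dimensional [End g] therefore transfers to [Hom(g, L)]. One application
    only gives maps that are invariant modulo [Hom(g, g (x) A)]; the second repairs this, because
    [g] is perfect.

    Cartan's criterion is reached without Jordan decomposition: a polynomial in [X] that takes at
    the eigenvalues the values of a rational functional does the work of the semisimple part.

    Any algebra [At] containing [A] makes [At / A] an [A]-module, so an [A]-action on [V / A] cannot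
    be avoided. The product of two elements of a complement is free, and zero is the choice that
    needs no further structure. *)

Lemma splitting_extension (F : fieldType) (p : {poly F}) : p != 0 ->
  exists (K : fieldType) (f : {rmorphism F -> K}) (s : seq K),
    map_poly f p = lead_coef (map_poly f p) *: \prod_(a <- s) ('X - a%:P).
Proof.
have [n] := ubnP (size p); elim: n F p => // n IHn F p /[!ltnS] sz_p p_neq0.
have [sz1|sz_gt1] := leqP (size p) 1.
  exists F, idfun, [::]; rewrite map_poly_id // big_nil.
  by rewrite (size1_polyC sz1) lead_coefC alg_polyC.
have [q [irr_q q_dvd_p]] : exists q, irreducible_poly q /\ q %| p.
  (* A nonconstant divisor of least degree is irreducible. *)
  pose P k := `[< exists q : {poly F}, [/\ (1 < size q)%N, q %| p & size q = k] >].
  have exP : exists k, P k.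
    by exists (size p); apply/asboolP; exists p; split=> //.
  case: (ex_minnP exP) => k /asboolP[q [q_gt1 q_p sz_q]] k_min.
  exists q; split=> //; split=> // r r_neq1 r_q.
  have q_neq0 : q != 0 by rewrite -size_poly_gt0 ltnW.
  have r_neq0 : r != 0 by apply: contraNneq q_neq0 => r0; rewrite r0 dvd0p in r_q.
  have sz_r : (1 < size r)%N.
    by rewrite ltn_neqAle eq_sym r_neq1 size_poly_gt0.
  rewrite -dvdp_size_eqp // eqn_leq dvdp_leq //= sz_q k_min //.
  by apply/asboolP; exists r; split=> //; apply: dvdp_trans q_p.
have [L _ [z rootz _]] := irredp_FAdjoin irr_q.
pose i : {rmorphism F -> L} := in_alg L.
have [r def_p] : exists r, map_poly i p = r * ('X - z%:P).
  apply/factor_theorem; have /dvdpP[u ->] := q_dvd_p.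
  by rewrite rmorphM rootM rootz orbT.
have ip_neq0 : map_poly i p != 0 by rewrite map_poly_eq0.
have r_neq0 : r != 0 by apply: contraNneq ip_neq0 => r0; rewrite def_p r0 mul0r.
have sz_r : (size r < n)%N.
  have := size_map_poly i p; rewrite def_p size_Mmonic ?monicXsubC //.
  by rewrite size_XsubC addn2 /= => e; move: sz_p; rewrite -e.
have [K [f [s def_r]]] := IHn L r sz_r r_neq0.
exists K, (f \o i), (f z :: s).
rewrite map_poly_comp def_p rmorphM /= map_polyXsubC lead_coefM lead_coefXsubC mulr1.
by rewrite big_cons mulrC [in LHS]def_r scalerAr.
Qed.

Lemma char_poly_uconj (R : comUnitRingType) n (P X : 'M[R]_n) : P \in unitmx ->
  char_poly (P *m X *m invmx P) = char_poly X.
Proof.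
move=> uP; rewrite /char_poly /char_poly_mx.
pose Q := map_mx polyC P; pose Q' := map_mx polyC (invmx P).
have QQ' : Q *m Q' = 1%:M by rewrite -map_mxM mulmxV // map_mx1.
have -> : 'X%:M - map_mx polyC (P *m X *m invmx P) =
   Q *m ('X%:M - map_mx polyC X) *m Q'.
  by rewrite !map_mxM -/Q -/Q' mulmxBr mulmxBl scalar_mxC -(mulmxA 'X%:M) QQ' mulmx1.
rewrite !det_mulmx mulrAC -det_mulmx.
by rewrite QQ' det1 mul1r.
Qed.

Lemma expmx_uconj (R : comUnitRingType) n (P X : 'M[R]_n) k : P \in unitmx ->
  (P *m X *m invmx P) ^+ k = P *m X ^+ k *m invmx P.
Proof.
move=> uP; elim: k => [|k IHk]; first by rewrite !expr0 mulmx1 mulmxV.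
rewrite !exprS IHk -[LHS]/(P *m X *m invmx P *m (P *m X ^+ k *m invmx P)).
by rewrite !mulmxA mulmxKV.
Qed.

(** Triangularisation by induction on [n]: with an eigenvector as first basis vector, [X] is block
    triangular with [a] in the corner, and the other diagonal block has the remaining roots. *)
Lemma mxtrace_exp_split (K : fieldType) n (X : 'M[K]_n) (s : seq K) :
  char_poly X = \prod_(a <- s) ('X - a%:P) ->
  forall k, \tr (X ^+ k) = \sum_(a <- s) a ^+ k.
Proof.
elim: n => [|n IHn] in X s *.
  case: s => [|a s] e k; first by rewrite /mxtrace big_ord0 big_nil.
  by have := size_char_poly X; rewrite e size_prod_XsubC.
case: s => [|a s].
  by move=> e; have := size_char_poly X; rewrite e big_nil size_poly1.
move=> def_s.
have /eigenvalueP[v vX v_neq0] : eigenvalue X a.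
  by rewrite eigenvalue_root_char def_s root_prod_XsubC mem_head.
(* As [v] has rank one, the first row of the invertible matrix [row_ebase v] spans the same line. *)
pose P := row_ebase v; have uP : P \in unitmx by apply: row_ebase_unit.
have rk_v : \rank v = 1%N by apply/eqP; rewrite eqn_leq rank_leq_row lt0n mxrank_eq0.
pose c := (col_ebase v) 0 0.
have def_v : v = c *: row 0 P.
  rewrite -[LHS]mulmx_ebase rk_v; apply/rowP => j.
  rewrite !mxE big_ord_recl big1 => [|i _].
    rewrite addr0; congr (_ * _); rewrite !mxE big_ord1 !mxE mulr1 //.
  rewrite [X in X * _]mxE big_ord1 [pid_mx _ _ _]mxE /= mulr0 mul0r //.
have c_neq0 : c != 0 by apply: contraNneq v_neq0 => c0; rewrite def_v c0 scale0r.
have rX : row 0 P *m X = a *: row 0 P.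
  apply: (scalerI c_neq0); rewrite scalemxAl -def_v vX def_v !scalerA mulrC //.
pose Y : 'M_(1 + n) := P *m X *m invmx P.
have Y0 : row 0 Y = a *: delta_mx 0 0.
  rewrite !row_mul rX -scalemxAl -row_mul mulmxV // row1 //.
have cY : char_poly Y = char_poly X by apply: char_poly_uconj.
have {}Y0 j : Y 0 j = a *+ (j == 0).
  by have := congr1 (fun m : 'rV_n.+1 => m 0 j) Y0; rewrite mxE => ->; rewrite !mxE mulr_natr.
have def_Y : Y = block_mx a%:M 0 (dlsubmx Y) (drsubmx Y).
  rewrite -[LHS]submxK; congr block_mx.
    apply/matrixP => i j; rewrite !ord1 [LHS]mxE [in LHS]mxE [RHS]mxE mulr1n.
    by rewrite (_ : lshift n 0 = 0) ?Y0 //; apply/val_inj.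
  apply/matrixP => i j; rewrite !ord1 [LHS]mxE [in LHS]mxE [RHS]mxE.
  by rewrite (_ : lshift n 0 = 0) ?Y0 //; apply/val_inj.
have cY2 : char_poly Y = ('X - a%:P) * char_poly (drsubmx Y).
  rewrite {1}def_Y /char_poly /char_poly_mx map_block_mx scalar_mx_block.
  rewrite opp_block_mx add_block_mx map_mx0 subr0 det_lblock det_mx11.
  by rewrite !mxE.
have {cY cY2}/IHn trD : char_poly (drsubmx Y) = \prod_(a <- s) ('X - a%:P).
  have /mulfI : 'X - a%:P != 0 :> {poly K} by rewrite monic_neq0 ?monicXsubC.
  by apply; rewrite -cY2 cY def_s big_cons.
move=> k; rewrite big_cons -trD.
have /(_ k)[u Yk] : forall k, exists u, Y ^+ k = block_mx (a ^+ k)%:M 0 u (drsubmx Y ^+ k).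
  elim=> [|j [u IHj]]; first by exists 0; rewrite !expr0 [LHS]scalar_mx_block.
  exists (a ^+ j *: dlsubmx Y + drsubmx Y *m u).
  rewrite [LHS]exprS -[LHS]/(Y *m Y ^+ j) IHj {1}def_Y.
  rewrite [LHS](mulmx_block (a%:M : 'M_1) (0 : 'M_(1, n)) _ _ _ 0).
  rewrite !exprS !mulmx0 !mul0mx !addr0 add0r.
  by rewrite -scalar_mxM mul_mx_scalar.
have Ya : Y ^+ k = P *m X ^+ k *m invmx P by apply: expmx_uconj.
have -> : \tr (X ^+ k) = \tr (Y ^+ k) by rewrite Ya mxtrace_mulC mulmxA mulVmx // mul1mx.
by rewrite Yk mxtrace_block mxtrace_scalar mulr1n.
Qed.

(** * Interpolation along commuting operators *)

Lemma mxtrace_horner_split (K : fieldType) n (X : 'M[K]_n.+1) (s : seq K) :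
  char_poly X = \prod_(a <- s) ('X - a%:P) ->
  forall p, \tr (horner_mx X p) = \sum_(a <- s) p.[a].
Proof.
move=> def_s p; rewrite -{1}[p]coefK poly_def !linear_sum /=.
under eq_bigr => i _ do rewrite !linearZ /= rmorphXn /= horner_mx_X
  (mxtrace_exp_split def_s) mulr_sumr.
by rewrite exchange_big; apply: eq_bigr => a _; rewrite horner_coef.
Qed.

Lemma coprimep_prod_XsubC_exp (K : fieldType) (s : seq K) b M N : b \notin s ->
  coprimep (\prod_(a <- s) ('X - a%:P) ^+ M) (('X - b%:P) ^+ N).
Proof.
move=> b_s; rewrite big_seq; elim/big_rec: _ => [|a r a_s cop]; first exact: coprime1p.
rewrite coprimepMl cop andbT coprimep_expl // coprimep_expr //.
by rewrite coprimep_XsubC root_XsubC; apply: contraNneq b_s => ->.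
Qed.

Lemma dvdp_prod_XsubC_exp (K : fieldType) (s : seq K) N h : uniq s ->
  {in s, forall a, ('X - a%:P) ^+ N %| h} ->
  \prod_(a <- s) ('X - a%:P) ^+ N %| h.
Proof.
elim: s => [|b s IHs] /=; first by rewrite big_nil dvd1p.
case/andP=> b_s uniq_s h_s; rewrite big_cons mulrC Gauss_dvdp ?coprimep_prod_XsubC_exp //.
rewrite h_s ?mem_head // andbT; apply: IHs => // a a_s.
by rewrite h_s // inE a_s orbT.
Qed.

(** Chinese remaindering by induction: [u * M] is 1 modulo the power at [b] and 0 modulo the others,
    so it corrects the value at [b] alone. *)
Lemma crt_XsubC (K : fieldType) (s : seq K) (f : K -> K) N : uniq s ->
  exists q : {poly K}, {in s, forall a, ('X - a%:P) ^+ N %| q - (f a)%:P}.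
Proof.
elim: s => [|b s IHs] /=; first by exists 0.
case/andP=> b_s /IHs[q qP].
pose M := \prod_(a <- s) ('X - a%:P) ^+ N.
have /Bezout_eq1_coprimepP[[u v] /= uv1] := coprimep_prod_XsubC_exp N N b_s.
rewrite -/M in uv1.
exists (q + u * M * ((f b)%:P - q)) => a; rewrite inE => /orP[/eqP->|a_s].
  have -> : u * M = 1 - v * ('X - b%:P) ^+ N by rewrite -uv1 addrK.
  rewrite mulrBl mul1r addrA (addrC q) subrK addrAC subrr add0r dvdpNr.
  by rewrite -mulrA dvdp_mull // dvdp_mulr.
rewrite addrAC dvdp_add ?qP // -mulrA dvdp_mull // dvdp_mulr //.
by rewrite /M (big_rem a) //= dvdp_mulr.
Qed.

Lemma comm_horner_alg (K : fieldType) (A : algType K) (x y : A) p :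
  GRing.comm x y -> GRing.comm x (horner_alg y p).
Proof.
move=> xy; elim/poly_ind: p => [|p c IHp]; first by rewrite linear0; apply: commr0.
rewrite rmorphD rmorphM /= horner_algX horner_algC.
apply: commrD; first exact: commrM.
by rewrite /GRing.comm -scalerAl -scalerAr mul1r mulr1.
Qed.

Lemma horner_alg_dvdp (K : fieldType) (A : algType K) (x w : A) (p q : {poly K}) :
  p %| q -> horner_alg x p * w = 0 -> horner_alg x q * w = 0.
Proof. by move=> /dvdpP[u ->] pw; rewrite rmorphM /= -mulrA pw mulr0. Qed.

(* On the simultaneous generalised eigenspace of [l] and [r] for [(a, b)], the
   operator [l - r - (a - b)] is nilpotent, so a polynomial congruent to
   [f (a - b)] modulo a high power of ['X - (a - b)] sends [l - r] to the
   scalar [f a - f b]. *)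
Lemma additive_interpolation (K : fieldType) (A : algType K) (l r : A)
    (s : seq K) (N : nat) (f : K -> K) :
    GRing.comm l r -> uniq s -> {morph f : a b / a - b} ->
    horner_alg l (\prod_(a <- s) ('X - a%:P) ^+ N) = 0 ->
    horner_alg r (\prod_(a <- s) ('X - a%:P) ^+ N) = 0 ->
  exists q p : {poly K},
    {in s, forall a, q.[a] = f a} /\
    horner_alg l q - horner_alg r q = horner_alg (l - r) p.
Proof.
set P := \prod_(a <- s) _ => lr uniq_s fB Pl Pr.
(* The exponent [N.+1] forces [q.[a] = f a] even for [N = 0]. *)
have [q qP] := crt_XsubC f N.+1 uniq_s.
(* On a simultaneous eigenspace the commuting [l - a] and [r - b] have vanishing [N]-th powers, so
   their difference has vanishing power [N + N]. Differences [a - b] may coincide, hence [undup]. *)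
have [p pP] := crt_XsubC f (N + N) (undup_uniq [seq a - b | a <- s, b <- s]).
exists q, p; split=> [a /qP /dvdpP[u]|].
  rewrite exprSr mulrA => /(congr1 (horner^~ a)).
  by rewrite !hornerE subrr mulr0 => /eqP; rewrite subr_eq0 => /eqP.
pose D := horner_alg l q - horner_alg r q - horner_alg (l - r) p.
suff : D = 0 by move/eqP; rewrite subr_eq0 => /eqP.
(* [e a] is 1 to order [N] at [a] and 0 at the other nodes: at [l] or [r] these are the projectors
   onto generalised eigenspaces, and they add up to 1. *)
have /choice[e eP] a : exists e : {poly K},
    {in s, forall b, ('X - b%:P) ^+ N %| e - (a == b)%:R%:P}.
  exact: crt_XsubC (fun b => (a == b)%:R) N uniq_s.
have sum_e : P %| \sum_(a <- s) e a - 1.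
  apply: dvdp_prod_XsubC_exp => // b b_s.
  rewrite (bigD1_seq b) //= -addrA (addrC (\sum_(i <- s | _) _)) addrA dvdp_add //.
    by have := eP b b b_s; rewrite eqxx.
  rewrite big_seq_cond; apply: (big_ind (fun x => _ %| x)); first exact: dvdp0.
    by move=> x y; apply: dvdp_add.
  by move=> a /andP[a_s /negPf nab]; have := eP a b b_s; rewrite nab subr0.
have e_loc a : a \in s -> P %| ('X - a%:P) ^+ N * e a.
  move=> a_s; apply: dvdp_prod_XsubC_exp => // b b_s.
  have [->|nab] := eqVneq a b; first exact: dvdp_mulr.
  by have := eP a b b_s; rewrite (negPf nab) subr0 => /dvdp_mull->.
have sum1 (x : A) : horner_alg x P = 0 -> \sum_(a <- s) horner_alg x (e a) = 1.
  move=> Px; have /dvdpP[u def_u] := sum_e.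
  have def_e : \sum_(a <- s) e a = u * P + 1 by rewrite -def_u subrK.
  rewrite -linear_sum /= def_e rmorphD rmorphM /= Px.
  by rewrite mulr0 add0r rmorph1.
have -> : D = D * (\sum_(a <- s) horner_alg l (e a) * \sum_(b <- s) horner_alg r (e b)).
  by rewrite -mulr_suml !sum1 // !mulr1.
rewrite mulr_sumr big_seq big1 // => a a_s; rewrite !mulr_sumr big_seq big1 // => b b_s.
set w := horner_alg l _ * _.
have la : (l - a%:A) ^+ N * w = 0.
  have := @horner_alg_dvdp K A l (horner_alg r (e b)) _ _ (e_loc a a_s).
  rewrite Pl mul0r rmorphM rmorphXn rmorphB /= horner_algX horner_algC -mulrA; exact.
have cw : horner_alg l (e a) * horner_alg r (e b) = horner_alg r (e b) * horner_alg l (e a).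
  exact/comm_horner_alg/commr_sym/comm_horner_alg/commr_sym.
have rb : (r - b%:A) ^+ N * w = 0.
  have := @horner_alg_dvdp K A r (horner_alg l (e a)) _ _ (e_loc b b_s).
  rewrite Pr mul0r rmorphM rmorphXn rmorphB /= horner_algX horner_algC -mulrA.
  by rewrite -cw; apply.
have scal (x : A) (h : {poly K}) (t : K) M :
    horner_alg x (('X - t%:P) ^+ M) * w = 0 -> ('X - t%:P) ^+ M %| h - (f t)%:P ->
    horner_alg x h * w = f t *: w.
  move=> xM /horner_alg_dvdp-/(_ _ x w xM); rewrite rmorphB /= horner_algC mulrBl.
  by move/eqP; rewrite subr_eq0 -scalerAl mul1r => /eqP.
rewrite /D !mulrBl (scal l q a N.+1) ?qP //; last first.
  by rewrite rmorphXn rmorphB /= horner_algX horner_algC exprS -mulrA la mulr0.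
rewrite (scal r q b N.+1) ?qP //; last first.
  by rewrite rmorphXn rmorphB /= horner_algX horner_algC exprS -mulrA rb mulr0.
rewrite (scal (l - r) p (a - b) (N + N)%N); first last.
- by apply: pP; rewrite mem_undup; apply/allpairsP; exists (a, b).
- rewrite rmorphXn rmorphB /= horner_algX horner_algC.
  have -> : l - r - (a - b)%:A = (l - a%:A) - (r - b%:A).
    by rewrite scalerBl !opprB addrACA [- r - _]addrC addrACA.
  have cxy : GRing.comm (l - a%:A) (r - b%:A).
    apply: commrB; last by rewrite /GRing.comm -scalerAl -scalerAr mul1r mulr1.
    apply/commr_sym/commrB; first exact/commr_sym.
    by rewrite /GRing.comm -scalerAl -scalerAr mul1r mulr1.
  rewrite exprBn_comm // mulr_suml big1 // => i _.
  rewrite mulrnAl -!mulrA; have [iN|Ni] := ltnP i N.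
    rewrite (mulrA _ _ w) (commrX _ (commr_sym (commrX _ (commr_sym cxy)))).
    rewrite -(mulrA _ _ w) -addnBA; last exact: ltnW.
    by rewrite (addnC N) exprD -(mulrA _ _ w) la !mulr0 mul0rn.
  have -> : (r - b%:A) ^+ i * w = 0 by rewrite -(subnK Ni) exprD -mulrA rb mulr0.
  by rewrite !mulr0 mul0rn.
by rewrite -scalerBl -fB subrr.
Qed.

(** * Linear retractions and rational functionals *)

(** Dimensions are unbounded, so Zorn's lemma provides a subspace [S] maximal among those meeting
    the image of [j] trivially. It is a complement, and [r v] is the unique [u] with [v - j u] in
    [S]. *)
Lemma linear_retraction (F : fieldType) (U V : lmodType F) (j : {linear U -> V}) :
  injective j -> exists r : {linear V -> U}, cancel j r.
Proof.
move=> j_inj.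
pose sub (S : set V) := forall c x y, S x -> S y -> S (c *: x + y).
pose P (S : set V) := sub S /\ forall u, S (j u) -> u = 0.
have [|S [[S_lin S_j] S_max]] := @Zorn_bigcup V P.
  move=> C CP C_tot; split=> [c x y [X CX Xx] [Y CY Yy]|u [X CX Xu]].
    have [XY|YX] := C_tot _ _ CX CY.
      by exists Y => //; apply: (CP _ CY).1 => //; apply: XY.
    by exists X => //; apply: (CP _ CX).1 => //; apply: YX.
  by apply: (CP _ CX).2.
(* [sub] admits the empty set, which serves the empty chain; maximality excludes it here. *)
have S0 : S 0.
  apply: contrapT => nS0; apply: (S_max [set 0]%classic); last first.
    split=> [c x y -> ->|u /= ju0]; first by rewrite /= scaler0 addr0.
    by apply: j_inj; rewrite ju0 linear0.
  split=> [x Sx|/(_ 0 erefl) //].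
  case: nS0; rewrite -[0](addNr x) -scaleN1r; exact: S_lin.
have SZ c x : S x -> S (c *: x) by move=> Sx; rewrite -[_ *: _]addr0; apply: S_lin.
have SD x y : S x -> S y -> S (x + y) by move=> Sx; rewrite -[x]scale1r; apply: S_lin.
have dec v : exists u, S (v - j u).
  apply: contrapT => nS.
  pose T := [set x | exists c s, S s /\ x = c *: v + s]%classic.
  apply: (S_max T).
    split=> [x Sx|TS]; first by exists 0, x; rewrite scale0r add0r.
    apply: nS; exists 0; rewrite linear0 subr0; apply: TS.
    by exists 1, 0; rewrite scale1r addr0.
  split=> [a _ _ [c [s [Ss ->]]] [d [t [St ->]]]|u [c [s [Ss def_ju]]]].
    exists (a * c + d), (a *: s + t); split; first exact: S_lin.
    by rewrite scalerDr scalerA addrACA -scalerDl.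
  have [c0|c_neq0] := eqVneq c 0.
    by apply: S_j; rewrite def_ju c0 scale0r add0r.
  case: nS; exists (c^-1 *: u); rewrite linearZ /= def_ju scalerDr scalerA mulVf //.
  by rewrite scale1r opprD addrA subrr add0r -scaleNr; apply: SZ.
have [r rP] := choice dec.
have r_uniq v u : S (v - j u) -> r v = u.
  move=> Sv; apply/eqP; rewrite -subr_eq0; apply/eqP/S_j.
  rewrite linearB /=.
  have -> : j (r v) - j u = (-1) *: (v - j (r v)) + (v - j u).
    by rewrite scaleN1r opprB addrA subrK.
  exact: S_lin.
have r_lin : linear r.
  move=> c x y; apply: r_uniq; rewrite linearP /= opprD addrACA -scalerN -scalerDr.
  exact: S_lin.
pose rM := GRing.isLinear.Build F V U *:%R r r_lin.
pose rL : {linear V -> U} := HB.pack r rM.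
by exists rL => u; apply: r_uniq; rewrite subrr.
Qed.

Lemma pchar0_natr_neq0 (F : fieldType) n : [pchar F] =i pred0 -> (n.+1%:R != 0 :> F).
Proof. by move=> /pcharf0P->. Qed.

Lemma pchar0_rat_rmorphism (F : fieldType) : [pchar F] =i pred0 ->
  exists f : {rmorphism rat -> F}, True.
Proof.
move=> charF0.
have int_neq0 (m : int) : m != 0 -> m%:~R != 0 :> F.
  case: m => [[|m]|m] // _; first exact: pchar0_natr_neq0.
  by rewrite NegzE mulrNz oppr_eq0; apply: pchar0_natr_neq0.
have den_neq0 x : (denq x)%:~R != 0 :> F by rewrite int_neq0 ?denq_neq0.
(* Sums and products produce unreduced fractions, so [ratr] must be known on any fraction equal to
   [x]. *)
have ratr_eq x (m d : int) : x * d%:~R = m%:~R -> @ratr F x * d%:~R = m%:~R.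
  move=> xd; have /intr_inj e : (numq x * d)%:~R = (m * denq x)%:~R :> rat.
    by rewrite !rmorphM /= numqE -xd mulrAC.
  by rewrite /ratr mulrAC -rmorphM e rmorphM; apply: mulfK; apply: den_neq0.
have ratr_num x : @ratr F x * (denq x)%:~R = (numq x)%:~R by apply: divfK; apply: den_neq0.
have addM : zmod_morphism (@ratr F).
  move=> x y; apply: (mulIf (den_neq0 x)); apply: (mulIf (den_neq0 y)).
  rewrite -mulrA -rmorphM (ratr_eq _ (numq x * denq y - numq y * denq x)).
    by rewrite intrB !intrM -!ratr_num !mulrBl -!mulrA (mulrC (denq x)%:~R).
  by rewrite intrB !intrM !numqE !mulrBl -!mulrA (mulrC (denq x)%:~R).
have mulM : monoid_morphism (@ratr F).
  split=> [|x y]; first by have := ratr_eq 1 1 1 (mulr1 _); rewrite mulr1.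
  apply: (mulIf (den_neq0 x)); apply: (mulIf (den_neq0 y)).
  rewrite -mulrA -rmorphM (ratr_eq _ (numq x * numq y)).
    by rewrite intrM -!ratr_num mulrACA mulrA.
  by rewrite !rmorphM /= !numqE mulrACA.
by exists (HB.pack_for {rmorphism rat -> F} (@ratr F)
  (GRing.isZmodMorphism.Build rat F _ addM) (GRing.isMonoidMorphism.Build rat F _ mulM)).
Qed.

(** An alias of [K], so that its structure of [E]-vector space through [h] does not clash with its
    own. *)
Definition restrict_scalars (E K : fieldType) (h : {rmorphism E -> K}) : Type := K.

Section RestrictScalars.
Variables (E K : fieldType) (h : {rmorphism E -> K}).
Let scale (c : E) (x : restrict_scalars h) : restrict_scalars h := h c * (x : K).

HB.instance Definition _ := GRing.Zmodule.on (restrict_scalars h).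

Let scaleA a b x : scale a (scale b x) = scale (a * b) x.
Proof. by rewrite /scale rmorphM mulrA. Qed.
Let scale1 : left_id 1 scale.
Proof. by move=> x; rewrite /scale rmorph1 mul1r. Qed.
Let scaleDr : right_distributive scale +%R.
Proof. by move=> c x y; rewrite /scale mulrDr. Qed.
Let scaleDl v : {morph scale^~ v : a b / a + b}.
Proof. by move=> a b; rewrite /scale rmorphD mulrDl. Qed.

HB.instance Definition _ := GRing.Zmodule_isLmodule.Build E (restrict_scalars h)
  scaleA scale1 scaleDr scaleDl.
End RestrictScalars.

(** Retract [K], seen over [E], onto the line of [a]. This is used with [E = rat], where a vanishing
    sum of squares has vanishing terms. *)
Lemma subfield_functional (E K : fieldType) (h : {rmorphism E -> K}) (a : K) : a != 0 ->
  exists f : K -> E, [/\ {morph f : x y / x - y}, forall c x, f (h c * x) = c * f x & f a = 1].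
Proof.
move=> a_neq0; pose j (c : E^o) : restrict_scalars h := h c * a.
have j_lin : linear j by move=> c x y; rewrite /j rmorphD rmorphM mulrDl -mulrA.
pose jL : {linear E^o -> restrict_scalars h} :=
  HB.pack j (GRing.isLinear.Build E E^o (restrict_scalars h) *:%R j j_lin).
have jL_inj : injective jL.
  move=> c d; rewrite /= /j => /(mulIf a_neq0) e; exact: fmorph_inj e.
have [r rK] := linear_retraction jL_inj.
exists r; split=> [x y|c x|]; first exact: (linearB r).
  exact: (linearZ_LR r c x).
by have := rK 1; rewrite /= /j rmorph1 mul1r.
Qed.

(** * Nilpotency from vanishing traces *)

Definition lmul_mx (K : fieldType) n (X : 'M[K]_n) : 'M[K]_(n * n) := lin_mulmx X.
Definition rmul_mx (K : fieldType) n (X : 'M[K]_n) : 'M[K]_(n * n) := lin_mulmxr X.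

(** Since matrices act on rows, the commutator is taken in the order [Z X - X Z]. *)
Definition ad_mx (K : fieldType) n (X : 'M[K]_n) : 'M[K]_(n * n) :=
  rmul_mx X - lmul_mx X.

Lemma mxvec_lmul (K : fieldType) n (X Z : 'M[K]_n) : mxvec Z *m lmul_mx X = mxvec (X *m Z).
Proof. exact: mul_vec_lin. Qed.

Lemma mxvec_rmul (K : fieldType) n (X Z : 'M[K]_n) : mxvec Z *m rmul_mx X = mxvec (Z *m X).
Proof. exact: mul_vec_lin. Qed.

Lemma mul_ad_mx (K : fieldType) n (X Z : 'M[K]_n) :
  mxvec Z *m ad_mx X = mxvec (Z *m X - X *m Z).
Proof.
by rewrite /ad_mx mulmxBr linearB /=; congr (_ - _); rewrite ?mxvec_lmul ?mxvec_rmul.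
Qed.

Lemma map_ad_mx (F K : fieldType) (f : {rmorphism F -> K}) n (X : 'M[F]_n) :
  map_mx f (ad_mx X) = ad_mx (map_mx f X).
Proof.
rewrite /ad_mx map_mxB; congr (_ - _); apply: map_lin_mx => Z /=; exact: map_mxM.
Qed.

Lemma eq_mxvec_mul (K : fieldType) m n p (A B : 'M[K]_(m * n, p)) :
  (forall Z, mxvec Z *m A = mxvec Z *m B) -> A = B.
Proof.
move=> AB; apply/row_matrixP => i; rewrite !rowE.
by have := AB (vec_mx (delta_mx 0 i)); rewrite vec_mxK.
Qed.

Lemma lmul_mxM (K : fieldType) n (X Y : 'M[K]_n) :
  lmul_mx (X *m Y) = lmul_mx Y *m lmul_mx X.
Proof.
by apply: eq_mxvec_mul => Z; rewrite mulmxA !(mxvec_lmul, mxvec_rmul) mulmxA.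
Qed.

Lemma rmul_mxM (K : fieldType) n (X Y : 'M[K]_n) :
  rmul_mx (X *m Y) = rmul_mx X *m rmul_mx Y.
Proof.
by apply: eq_mxvec_mul => Z; rewrite mulmxA !(mxvec_lmul, mxvec_rmul) mulmxA.
Qed.

Lemma lmul_mx1 (K : fieldType) n : @lmul_mx K n 1%:M = 1%:M.
Proof. by apply: eq_mxvec_mul => Z; rewrite mxvec_lmul mul1mx mulmx1. Qed.

Lemma rmul_mx1 (K : fieldType) n : @rmul_mx K n 1%:M = 1%:M.
Proof. by apply: eq_mxvec_mul => Z; rewrite mxvec_rmul !mulmx1. Qed.

(** Multiplicativity is asked only against [x] and on elements commuting with it, so that the
    product-reversing [lmul_mx] qualifies. *)
Lemma horner_alg_morph (K : fieldType) (A B : algType K) (f : A -> B) (x : A) p :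
    linear f -> f 1 = 1 ->
    (forall y, GRing.comm x y -> f (y * x) = f y * f x) ->
  horner_alg (f x) p = f (horner_alg x p).
Proof.
move=> f_lin f1 fM.
have f0 : f 0 = 0 by have := f_lin (-1) 0 0; rewrite !scaleN1r !oppr0 !addr0 addNr.
elim/poly_ind: p => [|p c IHp]; first by rewrite !rmorph0.
rewrite !rmorphD !rmorphM /= !horner_algX !horner_algC IHp -fM.
  by rewrite addrC -f1 -f_lin addrC.
exact: comm_horner_alg.
Qed.

Lemma lmul_mx_linear (K : fieldType) n : linear (@lmul_mx K n).
Proof.
move=> c Y Z; apply: eq_mxvec_mul => W.
by rewrite mulmxDr -scalemxAr !mxvec_lmul mulmxDl -scalemxAl linearP.
Qed.

Lemma rmul_mx_linear (K : fieldType) n : linear (@rmul_mx K n).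
Proof.
move=> c Y Z; apply: eq_mxvec_mul => W.
by rewrite mulmxDr -scalemxAr !mxvec_rmul mulmxDr -scalemxAr linearP.
Qed.

Lemma horner_lmul_mx (K : fieldType) n (X : 'M[K]_n.+1) p :
  horner_alg (lmul_mx X) p =
  lmul_mx (horner_alg X p).
Proof.
refine (@horner_alg_morph K 'M[K]_n.+1 'M[K]_(n.+1 * n.+1) (@lmul_mx K n.+1) X p _ _ _).
- exact: lmul_mx_linear.
- exact (lmul_mx1 K n.+1).
- by move=> Y XY; rewrite -XY; exact (lmul_mxM X Y).
Qed.

Lemma horner_rmul_mx (K : fieldType) n (X : 'M[K]_n.+1) p :
  horner_alg (rmul_mx X) p =
  rmul_mx (horner_alg X p).
Proof.
refine (@horner_alg_morph K 'M[K]_n.+1 'M[K]_(n.+1 * n.+1) (@rmul_mx K n.+1) X p _ _ _).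
- exact: rmul_mx_linear.
- exact (rmul_mx1 K n.+1).
- by move=> Y XY; exact (rmul_mxM Y X).
Qed.

Lemma horner_mx_alg (K : fieldType) n (X : 'M[K]_n.+1) p :
  horner_mx X p = horner_alg X p.
Proof.
elim/poly_ind: p => [|p c IHp]; first by rewrite !rmorph0.
rewrite !rmorphD !rmorphM /= IHp horner_mx_X horner_mx_C horner_algX horner_algC.
by congr (_ + _); exact/esym/scalemx1.
Qed.

Lemma stablemx_horner_alg (K : fieldType) m n (S : 'M[K]_(m, n.+1)) (X : 'M_n.+1) p :
  stablemx S X -> stablemx S (horner_alg X p).
Proof.
move=> SX; elim/poly_ind: p => [|p c IHp].
  by rewrite rmorph0; apply: stablemx0.
rewrite rmorphD rmorphM /= horner_algX horner_algC.
by rewrite stablemxD ?stablemxM // [_ *: 1]scalemx1 stablemxC.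
Qed.

(** If an eigenvalue [a] is nonzero, take a rational functional [f] with [f a = 1] and a polynomial
    [q] interpolating [f] at the eigenvalues. For [Y = q(X)], [ad_mx Y] is a polynomial in
    [ad_mx X], hence preserves [S], and the trace of [X Y], the sum of the [b * f b], vanishes.
    Applying [f] once more leaves a vanishing sum of rational squares. *)
Lemma char_poly_roots0 (K : fieldType) (n m : nat) (X : 'M[K]_n.+1) (s : seq K)
    (S : 'M[K]_(m, n.+1 * n.+1)) : [pchar K] =i pred0 ->
    char_poly X = \prod_(a <- s) ('X - a%:P) -> stablemx S (ad_mx X) ->
    (forall Y, stablemx S (ad_mx Y) -> \tr (X *m Y) = 0) ->
  {in s, forall a, a = 0}.
Proof.
move=> charK0 def_s SX trX a a_s; apply: contrapT => /eqP a_neq0.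
have [h _] := pchar0_rat_rmorphism charK0.
have [f [fB fZ fa]] := subfield_functional h a_neq0.
pose l := rmul_mx X; pose r := lmul_mx X.
have lr : l *m r = r *m l.
  by apply: eq_mxvec_mul => Z; rewrite !mulmxA !(mxvec_lmul, mxvec_rmul) mulmxA.
(* [size s] bounds every multiplicity, so Cayley-Hamilton gives [P(X) = 0]. *)
pose P := \prod_(b <- undup s) ('X - b%:P) ^+ size s.
have PX : horner_mx X P = 0.
  have /dvdpP[u ->] : char_poly X %| P.
    rewrite def_s /P -prodr_undup_exp_count.
    apply: (big_ind2 (fun p q : {poly K} => p %| q)) => // [p q p' q'|b _].
      exact: dvdp_mul.
    exact/dvdp_exp2l/count_size.
  by rewrite rmorphM /= Cayley_Hamilton mulr0.
have [|||||q [p [q_f qp]]] :=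
    @additive_interpolation K _ l r (undup s) (size s) (h \o f).
- exact lr.
- exact: undup_uniq.
- by move=> x y /=; rewrite fB rmorphB.
- by rewrite [LHS]horner_rmul_mx -horner_mx_alg PX -(subrr 0) -scaleN1r addrC
    rmul_mx_linear scaleN1r addNr.
- by rewrite [LHS]horner_lmul_mx -horner_mx_alg PX -(subrr 0) -scaleN1r addrC
    lmul_mx_linear scaleN1r addNr.
pose Y := horner_mx X q.
have /trX : stablemx S (ad_mx Y).
  have -> : ad_mx Y = horner_alg (l - r) p.
    by rewrite -qp /ad_mx [Y]horner_mx_alg -horner_lmul_mx -horner_rmul_mx.
  exact: stablemx_horner_alg.
rewrite -{1}[X]horner_mx_X -[_ *m Y]/(_ * horner_mx X q) -rmorphM.
rewrite (mxtrace_horner_split def_s) => /(congr1 f).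
have f0 : f 0 = 0 by rewrite -[in LHS](subrr 0) fB subrr.
have fN x : f (- x) = - f x by rewrite -sub0r fB f0 sub0r.
have fD x y : f (x + y) = f x + f y by rewrite -{1}[y]opprK fB fN opprK.
rewrite (big_morph f fD f0) f0 big_seq.
under eq_bigr => b b_s.
  rewrite hornerM hornerX q_f ?mem_undup //= mulrC fZ -expr2.
over.
rewrite -big_seq => /eqP; rewrite psumr_eq0 => [|b _]; last exact: sqr_ge0.
by move/allP/(_ a a_s); rewrite fa.
Qed.

(** The hypothesis on [Y] says that the kernel of one linear map over [F] lies in the kernel of
    another. This is a matrix identity, so it survives the passage to a splitting field. *)
Lemma trace_criterion_nilpotent (F : fieldType) n m (X : 'M[F]_n.+1)
    (S : 'M[F]_(m, n.+1 * n.+1)) : [pchar F] =i pred0 -> stablemx S (ad_mx X) ->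
    (forall Y, stablemx S (ad_mx Y) -> \tr (X *m Y) = 0) ->
  X ^+ n.+1 = 0.
Proof.
move=> charF0 SX trX.
have chX_neq0 : char_poly X != 0 by rewrite monic_neq0 ?char_poly_monic.
have [K [f [s]]] := splitting_extension chX_neq0.
rewrite map_char_poly (monicP (char_poly_monic _)) scale1r => def_s.
(* [nrm S Y] vanishes exactly when [S] is stable under [ad_mx Y]. *)
pose nrm (K : fieldType) (S : 'M[K]_(m, n.+1 * n.+1)) (Y : 'M[K]_n.+1) :=
  S *m ad_mx Y *m cokermx S.
have nrm_lin (K' : fieldType) S' : linear (@nrm K' S').
  move=> c Y Z; rewrite /nrm /ad_mx rmul_mx_linear lmul_mx_linear opprD addrACA.
  by rewrite -scalerBr mulmxDr mulmxDl -scalemxAr -scalemxAl.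
pose nrmL (K' : fieldType) S' : {linear 'M[K']_n.+1 -> 'M_(m, n.+1 * n.+1)} :=
  HB.pack (@nrm K' S') (GRing.isLinear.Build _ _ _ _ (@nrm K' S') (nrm_lin K' S')).
pose tr (K : fieldType) (X Y : 'M[K]_n.+1) : 'M[K]_1 := (\tr (X *m Y))%:M.
have tr_lin (K' : fieldType) X' : linear (@tr K' X').
  move=> c Y Z; rewrite /tr mulmxDr -scalemxAr linearD linearZ /= raddfD /=.
  by rewrite scale_scalar_mx.
pose trL (K' : fieldType) X' : {linear 'M[K']_n.+1 -> 'M_1} :=
  HB.pack (@tr K' X') (GRing.isLinear.Build _ _ _ _ (@tr K' X') (tr_lin K' X')).
have ker_tr : kermx (lin_mx (nrmL F S)) *m lin_mx (trL F X) = 0.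
  apply/row_matrixP => i; rewrite row_mul row0.
  set y := row i _; have yN : y *m lin_mx (nrmL F S) = 0.
    by rewrite /y -row_mul mulmx_ker row0.
  rewrite -[y]vec_mxK mul_vec_lin /= /tr trX ?raddf0 //.
  rewrite submxE; move: yN; rewrite -[y]vec_mxK mul_vec_lin /= vec_mxK => /eqP.
  by rewrite mxvec_eq0.
have trXf Y : stablemx (map_mx f S) (ad_mx Y) -> \tr (map_mx f X *m Y) = 0.
  rewrite submxE => SY.
  have := congr1 (map_mx f) ker_tr; rewrite map_mxM map_kermx map_mx0.
  rewrite (@map_lin_mx _ _ f _ _ _ _ _ (nrmL K (map_mx f S))); last first.
    by move=> Z; rewrite /= /nrm -map_cokermx -map_ad_mx -!map_mxM.
  rewrite (@map_lin_mx _ _ f _ _ _ _ _ (trL K (map_mx f X))); last first.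
    by move=> Z; rewrite /= /tr map_scalar_mx /= -trace_map_mx map_mxM.
  have /sub_kermxP/submxP[D def_Y] : mxvec Y *m lin_mx (nrmL K (map_mx f S)) = 0.
    by rewrite mul_vec_lin /= /nrm (eqP SY) linear0.
  move/(congr1 (mulmx D)); rewrite mulmxA -def_Y mulmx0 mul_vec_lin /= /tr.
  move/eqP; rewrite mxvec_eq0 => /eqP/matrixP/(_ 0 0).
  by rewrite !mxE eqxx mulr1n.
have charK0 : [pchar K] =i pred0 by move=> p; rewrite (fmorph_pchar f).
have s0 : {in s, forall a, a = 0}.
  apply: char_poly_roots0 def_s _ trXf => //.
  by rewrite -map_ad_mx -map_mxM map_submx.
have chX : char_poly X = 'X^(n.+1).
  apply: (map_poly_inj f); rewrite map_char_poly def_s map_polyXn.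
  have := congr1 (fun p : {poly K} => (size p).-1) def_s.
  rewrite size_char_poly size_prod_XsubC /= => ->.
  rewrite big_seq (eq_bigr (fun=> 'X)) => [|a /s0->]; last by rewrite subr0.
  by rewrite -big_seq big_const_seq count_predT iter_mulr_1.
by have := Cayley_Hamilton X; rewrite chX rmorphXn /= horner_mx_X.
Qed.

(** * Engel's theorem *)

Lemma nilpotent_mxtrace (F : fieldType) n (M : 'M[F]_n.+1) k : M ^+ k = 0 -> \tr M = 0.
Proof.
move=> Mk0; have chM_neq0 : char_poly M != 0 by rewrite monic_neq0 ?char_poly_monic.
have [K [f [s]]] := splitting_extension chM_neq0.
rewrite map_char_poly (monicP (char_poly_monic _)) scale1r => def_s.
apply: (fmorph_inj f); rewrite -trace_map_mx rmorph0 -[map_mx f M]expr1.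
rewrite (mxtrace_exp_split def_s) big_seq big1 // => a a_s; rewrite expr1.
have /eigenvalueP[v vM v_neq0] : eigenvalue (map_mx f M) a.
  by rewrite eigenvalue_root_char def_s root_prod_XsubC.
have vMk j : v *m (map_mx f M) ^+ j = a ^+ j *: v.
  elim: j => [|j IHj]; first by rewrite !expr0 mulmx1 scale1r.
  by rewrite !exprSr mulmxA IHj -scalemxAl vM scalerA.
have := vMk k; rewrite -rmorphXn /= Mk0 map_mx0 mulmx0 => /esym/eqP.
by rewrite scaler_eq0 (negPf v_neq0) orbF expf_eq0 => /andP[_ /eqP].
Qed.

Section BilinearOpp.
Variables (F : fieldType) (V W U : lmodType F) (f : V -> W -> U).
Hypothesis f_bil : bilinear_for *:%R *:%R f.

Lemma bilNl w v : f (- v) w = - f v w.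
Proof. by apply: (addrI (f v w)); rewrite -(bilDl f_bil) !subrr (bil0l f_bil). Qed.

Lemma bilNr v w : f v (- w) = - f v w.
Proof. by apply: (addrI (f v w)); rewrite -(bilDr f_bil) !subrr (bil0r f_bil). Qed.

Lemma bilBl w v v' : f (v - v') w = f v w - f v' w.
Proof. by rewrite (bilDl f_bil) bilNl. Qed.

Lemma bilBr v w w' : f v (w - w') = f v w - f v w'.
Proof. by rewrite (bilDr f_bil) bilNr. Qed.
End BilinearOpp.

Section LieAlgebraBasics.
Variables (F : fieldType) (L : lieAlgType F).
Implicit Types x y z : L.

Lemma lieDl x y z : lie (x + y) z = lie x z + lie y z.
Proof. exact: bilDl lie_is_bilinear _ _ _. Qed.
Lemma lieDr x y z : lie z (x + y) = lie z x + lie z y.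
Proof. exact: bilDr lie_is_bilinear _ _ _. Qed.
Lemma lieZl c x y : lie (c *: x) y = c *: lie x y.
Proof. exact: bilZl lie_is_bilinear _ _ _. Qed.
Lemma lieZr c x y : lie x (c *: y) = c *: lie x y.
Proof. exact: bilZr lie_is_bilinear _ _ _. Qed.
Lemma lie0l x : lie 0 x = 0.
Proof. exact: bil0l lie_is_bilinear _. Qed.
Lemma lie0r x : lie x 0 = 0.
Proof. exact: bil0r lie_is_bilinear _. Qed.
Lemma lieNr x y : lie x (- y) = - lie x y.
Proof. exact: bilNr lie_is_bilinear _ _. Qed.

Lemma lie_lie x y z : lie (lie x y) z = lie x (lie y z) - lie y (lie x z).
Proof.
have /eqP := jacobi x y z; rewrite -addrA addr_eq0 => /eqP->.
by rewrite (lieC _ z) (lieC x z) lieNr opprK opprD addrAC addNr add0r.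
Qed.

End LieAlgebraBasics.

Section Engel.
Variables (F : fieldType) (g : finLieAlgType F).
Hypothesis ad_nilp : forall x : g, exists k, forall y, iter k (lie x) y = 0.

(** Engel's theorem for [H] acting on [W / W'], phrased without quotients because the induction uses
    it for two of them: on [H / K] with [K] a maximal proper subalgebra, giving [x] with [H = K +
    <[x]>], then on [W / W'] under [K]. *)
Lemma engel (H W W' : {vspace g}) :
    {in H &, forall x y, lie x y \in H} ->
    (forall x w, x \in H -> w \in W -> lie x w \in W) ->
    (forall x w, x \in H -> w \in W' -> lie x w \in W') ->
    (W' <= W)%VS -> ~~ (W <= W')%VS ->
  exists w, [/\ w \in W, w \notin W' & {in H, forall x, lie x w \in W'}].
Proof.
have [m] := ubnP (\dim H); elim: m H W W' => // m IHm H W W' /[!ltnS] dimH HH HW HW' W'W WW'.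
have [->|H_neq0] := eqVneq H 0%VS.
  have /subvPn[w wW wW'] := WW'; exists w; split=> // x.
  by rewrite memv0 => /eqP->; rewrite lie0l mem0v.
pose P k := `[< exists K : {vspace g},
  [/\ \dim K = k, (K <= H)%VS, K != H & {in K &, forall x y, lie x y \in K}] >].
have exP : exists k, P k.
  exists 0%N; apply/asboolP; exists 0%VS; rewrite dimv0 sub0v eq_sym.
  by split=> // x y; rewrite !memv0 => /eqP-> _; rewrite lie0l.
have ubP k : P k -> (k <= \dim H)%N.
  by move=> /asboolP[K [<- KH _ _]]; apply: dimvS.
case: (ex_maxnP exP ubP) => k /asboolP[K [dimK KH nKH KK]] k_max.
have dimKH : (\dim K < \dim H)%N by rewrite ltn_neqAle (dimv_leqif_eq KH).2 nKH dimvS.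
have ltK : (\dim K < m)%N := leq_trans dimKH dimH.
have nHK : ~~ (H <= K)%VS by apply: contra nKH => HK; rewrite eqEsubv KH.
have KsubH x : x \in K -> x \in H := subvP KH x.
have [||x [xH xK Kx]] := IHm K H K ltK KK _ _ KH nHK.
- by move=> x y xK yH; apply: HH => //; apply: KsubH.
- by move=> x y xK yK; apply: KK.
have def_H : H = (K + <[x]>)%VS.
  have sub : (K + <[x]> <= H)%VS by rewrite subv_add KH -memvE.
  apply/eqP; rewrite eq_sym; apply: contraT => neq.
  have : (\dim (K + <[x]>) <= k)%N.
    apply: k_max; apply/asboolP; exists (K + <[x]>)%VS; split=> //.
    move=> _ _ /memv_addP[u uK [_ /vlineP[a ->] ->]] /memv_addP[v vK [_ /vlineP[b ->] ->]].
    have xuK : lie u (b *: x) \in K by rewrite lieZr memvZ ?Kx.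
    have xvK : lie (a *: x) v \in K by rewrite lieZl memvZ // lieC memvN Kx.
    apply: (subvP (addvSl _ _)); rewrite lieDl !lieDr [lie (a *: x) (b *: x)]lieZl.
    rewrite (lieZr b x x) liexx !scaler0 addr0; do 2!apply: memvD => //. exact: KK.
  rewrite -dimK => le_dim; have : (K == K + <[x]>)%VS.
    by rewrite -(dimv_leqif_eq (addvSl K <[x]>)).2 eqn_leq le_dim dimvS ?addvSl.
  move/eqP=> def_K; case/negP: xK.
  by rewrite def_K (subvP (addvSr _ _)) // memv_line.
have [||||w [wW wW' Kw]] := IHm K W W' ltK KK.
- by move=> y u yK; apply: HW; apply: KsubH.
- by move=> y u yK; apply: HW'; apply: KsubH.
- by [].
- by [].
pose good u := [/\ u \in W & {in K, forall y, lie y u \in W'}].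
have good_x u : good u -> good (lie x u).
  move=> [uW uK]; split; first exact: HW.
  move=> y yK; have -> : lie y (lie x u) = lie (lie y x) u + lie x (lie y u).
    by rewrite lie_lie subrK.
  by apply: memvD; [apply: uK; apply: Kx | apply: HW' => //; apply: uK].
have good_iter j : good (iter j (lie x) w).
  by elim: j => [|j IHj]; [split | rewrite iterS; apply: good_x].
have exj : exists j, iter j (lie x) w \in W'.
  by have [j xj0] := ad_nilp x; exists j; rewrite xj0 mem0v.
(* The vectors of [W] that [K] sends into [W'] are stable under [x]; the last iterate of [w] outside
   [W'] is the vector sought. *)
case: (ex_minnP exj) => [[|j]] wj j_min; first by rewrite wj in wW'.
have [uW uK] := good_iter j.
exists (iter j (lie x) w); split=> //.
  by apply/negP => /j_min; rewrite ltnn.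
move=> y; rewrite {1}def_H => /memv_addP[u1 u1K [_ /vlineP[a ->] ->]].
by rewrite lieDl lieZl memvD ?uK // memvZ.
Qed.
End Engel.

(** * Simple Lie algebras *)

Section SimpleLie.
Variables (F : fieldType) (g : finLieAlgType F).
Hypothesis g_simple : simple_lie g.
Hypothesis charF0 : [pchar F] =i pred0.

Lemma simple_ker0 (V : vectType F) (f : {linear g -> V}) :
    (forall x y, f y = 0 -> f (lie x y) = 0) -> (exists x, f x != 0) ->
  forall x, f x = 0 -> x = 0.
Proof.
move=> f_ideal [x fx] y fy.
have [|ker0|kerT] := g_simple.2 (lker (linfun f)).
- by move=> u v; rewrite !memv_ker !lfunE /= => /eqP/f_ideal->.
- by apply/eqP; rewrite -memv0 -ker0 memv_ker lfunE fy.
- by move: (memvf x); rewrite -kerT memv_ker lfunE (negPf fx).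
Qed.

(** Perfectness of [g], tested on maps into an arbitrary vector space because a later target is the
    possibly infinite-dimensional [{ffun _ -> L}]. *)
Lemma simple_perfect (V : lmodType F) (f : {linear g -> V}) :
  (forall x y, f (lie x y) = 0) -> forall x, f x = 0.
Proof.
move=> f0 x; pose b := vbasis {:g}.
pose D := <<[seq lie y z | y <- b, z <- b]>>%VS.
have lieD y z : lie y z \in D.
  rewrite (coord_vbasis (memvf y)) (coord_vbasis (memvf z)).
  rewrite (big_morph (lie^~ _) (fun u v => lieDl u v _) (lie0l _)).
  apply: memv_suml => i _; rewrite lieZl memvZ //.
  rewrite (big_morph (lie _) (fun u v => lieDr u v _) (lie0r _)).
  apply: memv_suml => j _; rewrite lieZr memvZ //.
  by apply: memv_span; apply/allpairsP; exists (b`_i, b`_j); rewrite !mem_nth ?size_tuple.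
have [|D0|DT] := g_simple.2 D; first by move=> y z _; apply: lieD.
  have [y [z]] := g_simple.1; rewrite -memv0 -D0 lieD //.
pose s := in_tuple [seq lie y z | y <- b, z <- b].
have xD : x \in <<s>>%VS by rewrite -[<<s>>%VS]/D DT memvf.
rewrite (coord_span xD) linear_sum big1 // => i _; rewrite linearZ /=.
have /allpairsP[[y z] /= [_ _ ->]] : s`_i \in s by apply: mem_nth.
by rewrite f0 scaler0.
Qed.

Lemma simple_center0 (w : g) : (forall x, lie x w = 0) -> w = 0.
Proof.
have lin_lie (u : g) : linear (lie u) by move=> c v z; rewrite lieDr lieZr.
pose lieL u : {linear g -> g} := HB.pack (lie u) (GRing.isLinear.Build _ _ _ _ _ (lin_lie u)).
have ad_lin : linear (fun u => linfun (lieL u)).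
  move=> c u v; apply/lfunP => z.
  by rewrite add_lfunE scale_lfunE !lfunE /= lieDl lieZl.
pose ad : {linear g -> 'End(g)} := 
  HB.pack (fun u => linfun (lieL u)) (GRing.isLinear.Build _ _ _ _ _ ad_lin).
move=> w_central; apply: (@simple_ker0 _ ad) => [x y /lfunP y0||].
- apply/lfunP => z; have y0' u : lie y u = 0 by have := y0 u; rewrite !lfunE.
  by rewrite !lfunE /= lie_lie !y0' lie0r subrr.
- have [x [y xy]] := g_simple.1; exists x; apply: contra xy => /eqP/lfunP/(_ y).
  by rewrite !lfunE /= => ->.
by apply/lfunP => z; rewrite !lfunE /= lieC w_central oppr0.
Qed.

(** Otherwise Engel's theorem with [W = g] and [W' = 0] gives a nonzero central element. *)
Lemma not_all_ad_nilpotent :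
  ~ forall x : g, exists k, forall y, iter k (lie x) y = 0.
Proof.
move=> nilp; have [x [y xy]] := g_simple.1.
have g_neq0 : (fullv : {vspace g}) != 0%VS.
  apply/eqP => g0; have : y \in (fullv : {vspace g}) by apply: memvf.
  by rewrite g0 memv0 => /eqP y0; rewrite y0 lie0r eqxx in xy.
have [] := @engel _ _ nilp {:g}%VS fullv 0%VS.
- by move=> *; apply: memvf.
- by move=> *; apply: memvf.
- by move=> u v _; rewrite memv0 => /eqP->; rewrite lie0r mem0v.
- exact: sub0v.
- by rewrite subv0.
move=> w [_ + w_central]; rewrite memv0 => /eqP; apply.
apply: simple_center0 => u; apply/eqP; rewrite -memv0; apply: w_central; apply: memvf.
Qed.
End SimpleLie.

(** * Cartan's criterion *)

Lemma ad_mx_nilpotent (K : fieldType) n (X : 'M[K]_n) k :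
  X ^+ k = 0 -> ad_mx X ^+ (k + k) = 0.
Proof.
move=> Xk0.
have powr j : rmul_mx X ^+ j = rmul_mx (X ^+ j).
  elim: j => [|j IHj]; first exact/esym/rmul_mx1.
  by rewrite !exprSr IHj -[RHS]/(rmul_mx (X ^+ j *m X)) rmul_mxM.
have powl j : lmul_mx X ^+ j = lmul_mx (X ^+ j).
  elim: j => [|j IHj]; first exact/esym/lmul_mx1.
  by rewrite exprS exprSr IHj -[RHS]/(lmul_mx (X ^+ j *m X)) lmul_mxM.
have r0 : rmul_mx X ^+ k = 0.
  by rewrite powr Xk0; apply: eq_mxvec_mul => Z; rewrite mxvec_rmul !mulmx0 linear0.
have l0 : lmul_mx X ^+ k = 0.
  by rewrite powl Xk0; apply: eq_mxvec_mul => Z; rewrite mxvec_lmul mul0mx mulmx0 linear0.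
rewrite exprBn_comm; last first.
  by apply: eq_mxvec_mul => Z; rewrite !mulmxA !(mxvec_lmul, mxvec_rmul) mulmxA.
rewrite big1 // => i _; have [ik|ki] := ltnP i k.
  by rewrite -addnBA 1?ltnW // exprD r0 mul0r mulr0 mul0r mul0rn.
by rewrite -(subnK ki) [lmul_mx X ^+ _]exprD l0 !mulr0 mul0rn.
Qed.

(* Matrices act on row vectors, so a representation is an anti-homomorphism
   for the matrix product. *)
Definition lie_rep_mx (F : fieldType) (g : lieAlgType F) N (rho : g -> 'M[F]_N) :=
  linear rho /\ forall x y, rho (lie x y) = rho y *m rho x - rho x *m rho y.

Section TraceForms.
Variables (F : fieldType) (g : finLieAlgType F).
Hypothesis g_simple : simple_lie g.
Hypothesis charF0 : [pchar F] =i pred0.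

(** The trace criterion with [S] spanned by [rho(g)] makes every [rho x] nilpotent. A nonzero [rho]
    is faithful by simplicity, and then all of [g] would be ad-nilpotent. *)
Lemma cartan_criterion N (rho : g -> 'M[F]_N) : lie_rep_mx rho ->
  (forall x y, \tr (rho x *m rho y) = 0) -> forall x, rho x = 0.
Proof.
case: N rho => [|N] rho [rho_lin rhoM] tr0; first by move=> x; rewrite [LHS]flatmx0.
pose rhoL : {linear g -> 'M[F]_N.+1} := HB.pack rho (GRing.isLinear.Build _ _ _ _ _ rho_lin).
pose S : 'M[F]_(\dim {:g}, N.+1 * N.+1) := \matrix_i mxvec (rho (vbasis {:g})`_i).
have rho_sum (c : 'I_(\dim {:g}) -> F) :
    mxvec (rho (\sum_i c i *: (vbasis {:g})`_i)) = \sum_i c i *: row i S.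
  rewrite -[rho]/(rhoL : _ -> _) !linear_sum; apply: eq_bigr => i _.
  by rewrite !linearZ rowK.
have S_rho z : (mxvec (rho z) <= S)%MS.
  rewrite (coord_vbasis (memvf z)) rho_sum.
  by apply: summx_sub => i _; rewrite scalemx_sub // row_sub.
have rho_S (v : 'rV_(N.+1 * N.+1)) : (v <= S)%MS -> exists z, v = mxvec (rho z).
  move=> /submxP[D ->]; exists (\sum_i D 0 i *: (vbasis {:g})`_i).
  by rewrite rho_sum mulmx_sum_row.
have mxvec_ad x y : mxvec (rho y) *m ad_mx (rho x) = mxvec (rho (lie x y)).
  by rewrite mul_ad_mx rhoM.
have rho_nilp x : rho x ^+ N.+1 = 0.
  apply: (@trace_criterion_nilpotent _ _ _ _ S) => //.
    by apply/row_subP => i; rewrite row_mul rowK mxvec_ad.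
  move=> Y SY; pose trY (z : g) : F^o := \tr (rho z *m Y).
  have trY_lin : linear trY.
    by move=> c u v; rewrite /trY rho_lin mulmxDl -scalemxAl linearP.
  pose trYL : {linear g -> F^o} := HB.pack trY (GRing.isLinear.Build F g F^o *:%R trY trY_lin).
  (* By perfectness it suffices to treat brackets: the trace of [rho [a, b] Y] is that of
     [rho b (rho a Y - Y rho a)], whose second factor lies in [rho(g)] because [Y] normalises it. *)
  apply: (@simple_perfect _ _ g_simple _ trYL) => a b /=; rewrite /trY rhoM.
  have [c] : exists c, mxvec (rho a) *m ad_mx Y = mxvec (rho c).
    by apply: rho_S; apply: submx_trans SY; apply: submxMr.
  rewrite mul_ad_mx => /(can_inj mxvecK) ac.
  rewrite mulmxBl linearB /= -!mulmxA [X in _ - X]mxtrace_mulC -mulmxA -linearB /=.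
  by rewrite -mulmxBr ac.
move=> x; apply: contrapT => /eqP rho_x.
have rho_inj : injective rhoL.
  apply: raddf_inj; apply: (simple_ker0 g_simple) => /= [u v v0|].
    by rewrite rhoM v0 mulmx0 mul0mx subrr.
  by exists x.
apply: (not_all_ad_nilpotent g_simple) => y; exists (N.+1 + N.+1)%N => z.
have iterE k : mxvec (rho (iter k (lie y) z)) = mxvec (rho z) *m ad_mx (rho y) ^+ k.
  elim: k => [|k IHk]; first by rewrite expr0 mulmx1.
  by rewrite iterS -mxvec_ad IHk exprSr mulmxA.
apply: rho_inj; apply: (can_inj mxvecK).
by rewrite [LHS]iterE ad_mx_nilpotent // mulmx0 !linear0.
Qed.
End TraceForms.

(** * The Killing form *)

Definition lie_module (F : fieldType) (g : lieAlgType F) (X : lmodType F)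
    (act : g -> X -> X) :=
  bilinear_for *:%R *:%R act /\
  forall x y v, act (lie x y) v = act x (act y v) - act y (act x v).

Lemma adjoint_module (F : fieldType) (g : lieAlgType F) : lie_module (@lie F g).
Proof. by split; [apply: lie_is_bilinear | apply: lie_lie]. Qed.

Definition rep_mx (F : fieldType) (g : lieAlgType F) (E : vectType F)
    (act : g -> E -> E) x : 'M[F]_(dim E) :=
  lin1_mx (fun v => v2r (act x (r2v v))).

Section RepMx.
Variables (F : fieldType) (g : lieAlgType F) (E : vectType F) (act : g -> E -> E).
Hypothesis act_mod : lie_module act.

Lemma mul_rep_mx x v : v2r v *m rep_mx act x = v2r (act x v).
Proof.
have f_lin : linear (fun v : 'rV[F]_(dim E) => v2r (act x (r2v v))).
  by move=> c u w; rewrite linearP (bilDr act_mod.1) (bilZr act_mod.1) linearP.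
pose f : {linear 'rV[F]_(dim E) -> 'rV[F]_(dim E)} :=
  HB.pack (fun v : 'rV[F]_(dim E) => v2r (act x (r2v v)))
    (GRing.isLinear.Build _ _ _ _ _ f_lin).
by rewrite (@mul_rV_lin1 _ _ _ f) /= v2rK.
Qed.

Lemma eq_v2r_mulmx m (A B : 'M[F]_(dim E, m)) :
  (forall v : E, v2r v *m A = v2r v *m B) -> A = B.
Proof.
move=> AB; apply/row_matrixP => i; rewrite !rowE.
by have := AB (r2v (delta_mx 0 i)); rewrite r2vK.
Qed.

Lemma rep_mx_lie_rep : lie_rep_mx (rep_mx act).
Proof.
split=> [c x y|x y]; apply: eq_v2r_mulmx => v.
  by rewrite mulmxDr -scalemxAr !mul_rep_mx (bilDl act_mod.1) (bilZl act_mod.1) linearP.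
by rewrite mulmxBr !mulmxA !mul_rep_mx act_mod.2 linearB.
Qed.

Lemma rep_mx_eq0 x : rep_mx act x = 0 -> forall v, act x v = 0.
Proof.
by move=> x0 v; apply: (can_inj v2rK); rewrite -mul_rep_mx x0 mulmx0 linear0.
Qed.
End RepMx.

Lemma mxtrace_commutator (R : comNzRingType) N (X Y Z : 'M[R]_N) :
  \tr ((Y *m X - X *m Y) *m Z) = \tr (X *m (Z *m Y - Y *m Z)).
Proof.
rewrite mulmxBl mulmxBr !linearB /= !mulmxA; congr (_ - _).
by rewrite -!mulmxA mxtrace_mulC mulmxA.
Qed.

Section InvariantForms.
Variables (F : fieldType) (g : finLieAlgType F).
Hypotheses (g_simple : simple_lie g) (g_central : central_lie g).
Hypothesis charF0 : [pchar F] =i pred0.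
Implicit Types x y z : g.

Definition killing x y : F := \tr (rep_mx lie x *m rep_mx lie y).
Local Notation n := (\dim {:g}).
Definition lie_basis (i : 'I_n) : g := (vbasis {:g})`_i.
Local Notation e_ := lie_basis.

Lemma killingC x y : killing x y = killing y x.
Proof. exact: mxtrace_mulC. Qed.

Lemma killingP c x y z : killing (c *: x + y) z = c * killing x z + killing y z.
Proof.
rewrite /killing (rep_mx_lie_rep (adjoint_module g)).1.
by rewrite mulmxDl -scalemxAl mxtraceD mxtraceZ.
Qed.

Lemma bilinear_suml (tau : g -> g -> F^o) (I : finType) (c : I -> F) (f : I -> g) z :
  bilinear_for *:%R *:%R tau -> tau (\sum_i c i *: f i) z = \sum_i c i * tau (f i) z.
Proof.
move=> tau_bil; rewrite (big_morph (tau^~ z) (fun x y => bilDl tau_bil z x y) (bil0l tau_bil z)).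
by apply: eq_bigr => i _; rewrite (bilZl tau_bil).
Qed.

Lemma bilinear_sumr (tau : g -> g -> F^o) (I : finType) (c : I -> F) (f : I -> g) z :
  bilinear_for *:%R *:%R tau -> tau z (\sum_i c i *: f i) = \sum_i c i * tau z (f i).
Proof.
move=> tau_bil; rewrite (big_morph (tau z) (fun x y => bilDr tau_bil z x y) (bil0r tau_bil z)).
by apply: eq_bigr => i _; rewrite (bilZr tau_bil).
Qed.

Lemma killing_bilinear : bilinear_for *:%R *:%R (killing : g -> g -> F^o).
Proof.
by split=> [z c x y|z c x y]; rewrite ?(killingC z) [LHS]killingP.
Qed.

Let killing_suml (I : finType) (c : I -> F) (f : I -> g) z :
  killing (\sum_i c i *: f i) z = \sum_i c i * killing (f i) z.
Proof. exact: bilinear_suml killing_bilinear. Qed.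

Let killing_sumr (I : finType) (c : I -> F) (f : I -> g) z :
  killing z (\sum_i c i *: f i) = \sum_i c i * killing z (f i).
Proof. exact: bilinear_sumr killing_bilinear. Qed.

Lemma killingNl x y : killing (- x) y = - killing x y.
Proof. exact: bilNl killing_bilinear _ _. Qed.

Lemma killing_invariant x y z : killing (lie x y) z = killing x (lie y z).
Proof.
by rewrite /killing !(rep_mx_lie_rep (adjoint_module g)).2 mxtrace_commutator.
Qed.

(** The radical is an ideal, so it is 0 unless the whole form vanishes; in that case Cartan's
    criterion for the adjoint representation would make [g] abelian. *)
Lemma killing_nondegenerate x : (forall y, killing x y = 0) -> x = 0.
Proof.
pose f x : 'rV[F]_n := \row_i killing x (e_ i).
have f_lin : linear f by move=> c y z; apply/rowP => i; rewrite !mxE killingP.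
pose fL : {linear g -> 'rV[F]_n} := HB.pack f (GRing.isLinear.Build _ _ _ _ _ f_lin).
have f0 y : fL y = 0 <-> forall z, killing y z = 0.
  split=> [/rowP y0 z|y0]; last by apply/rowP => i; rewrite !mxE y0.
  rewrite (coord_vbasis (memvf z)) killing_sumr big1 // => i _.
  by have := y0 i; rewrite !mxE => ->; rewrite mulr0.
move=> x0; apply: (@simple_ker0 _ _ g_simple _ fL); last exact/f0.
  by move=> y z /f0 z0; apply/f0 => u; rewrite lieC killingNl killing_invariant z0 oppr0.
apply: contrapT => k0; have [y [z /eqP[]]] := g_simple.1.
apply: (@rep_mx_eq0 _ _ _ _ (adjoint_module g)).
apply: (cartan_criterion g_simple charF0 (rep_mx_lie_rep (adjoint_module g))) => u v.
by apply: (f0 u).1; apply: contrapT => /eqP fu; apply: k0; exists u.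
Qed.

Definition killing_gram : 'M[F]_n := \matrix_(i, j) killing (e_ i) (e_ j).

Lemma killing_gram_unit : killing_gram \in unitmx.
Proof.
rewrite -row_free_unit -kermx_eq0; apply/eqP/row_matrixP => k; rewrite row0.
set v := row k _; have vG : v *m killing_gram = 0 by rewrite -row_mul mulmx_ker row0.
have /freeP free_e : free (vbasis {:g}) := basis_free (vbasisP _).
apply/rowP => i; rewrite [RHS]mxE; apply: free_e i.
apply: killing_nondegenerate => z.
rewrite (coord_vbasis (memvf z)) killing_sumr big1 // => j _.
rewrite [X in killing X _](_ : _ = \sum_i v 0 i *: e_ i) // killing_suml.
rewrite [X in _ * X](_ : _ = 0) ?mulr0 //.
have /rowP/(_ j) := vG; rewrite mxE [RHS]mxE => vG0; rewrite -[RHS]vG0.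
by apply: eq_bigr => i _; rewrite [killing_gram _ _]mxE.
Qed.

Definition dual_basis (j : 'I_n) : g := \sum_k invmx killing_gram k j *: e_ k.
Local Notation d_ := dual_basis.

Lemma killing_dual i j : killing (e_ i) (d_ j) = (i == j)%:R.
Proof.
rewrite killing_sumr.
have := mulmxV killing_gram_unit => /matrixP/(_ i j); rewrite !mxE => <-.
by apply: eq_bigr => k _; rewrite mxE mulrC.
Qed.

Lemma lie_basis_coord x : x = \sum_i coord (vbasis {:g}) i x *: e_ i.
Proof. by rewrite -coord_vbasis ?memvf. Qed.

Lemma coord_killing x i : coord (vbasis {:g}) i x = killing x (d_ i).
Proof.
rewrite [in RHS](lie_basis_coord x) killing_suml (bigD1 i) //= killing_dual eqxx mulr1.
by rewrite big1 ?addr0 // => j /negPf ij; rewrite killing_dual ij mulr0.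
Qed.

Lemma killing_expand x : x = \sum_i killing x (d_ i) *: e_ i.
Proof. by rewrite [LHS]lie_basis_coord; under eq_bigr do rewrite coord_killing. Qed.

Lemma killing_expand_dual x : x = \sum_i killing x (e_ i) *: d_ i.
Proof.
apply/eqP; rewrite -subr_eq0; apply/eqP/killing_nondegenerate => z.
rewrite [LHS](bilDl killing_bilinear) killingNl killing_suml.
rewrite {1}(killing_expand z) killing_sumr.
apply/eqP; rewrite subr_eq0; apply/eqP; apply: eq_bigr => i _.
by rewrite mulrC (killingC z).
Qed.

(* A form is [killing (phi x) y] for some [phi]; invariance puts [phi] in the
   centroid. *)
Lemma invariant_form_killing (tau : g -> g -> F^o) :
    bilinear_for *:%R *:%R tau ->
    (forall x y z, tau (lie x y) z = tau x (lie y z)) ->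
  exists c : F, forall x y, tau x y = c * killing x y.
Proof.
move=> tau_bil tau_inv; pose phi x := \sum_i (tau x (e_ i) : F) *: d_ i.
have phi_lin : linear phi.
  move=> c x y; rewrite /phi scaler_sumr -big_split; apply: eq_bigr => i _ /=.
  by rewrite (bilDl tau_bil) (bilZl tau_bil) scalerDl scalerA.
pose phiL : {linear g -> g} := HB.pack phi (GRing.isLinear.Build _ _ _ _ _ phi_lin).
have phiE x y : killing (phi x) y = tau x y.
  rewrite killing_suml {2}(killing_expand y) (bilinear_sumr _ _ _ tau_bil).
  by apply: eq_bigr => i _; rewrite mulrC (killingC _ y).
have phi_lie x y : phi (lie x y) = lie (phi x) y.
  apply/eqP; rewrite -subr_eq0; apply/eqP/killing_nondegenerate => z.
  rewrite [LHS](bilDl killing_bilinear) killingNl phiE tau_inv -phiE.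
  by rewrite -killing_invariant subrr.
have [|c phi_c] := g_central (f := linfun phiL).
  move=> a b; rewrite !lfunE /= phi_lie; split=> //.
  by rewrite lieC -phi_lie lieC -[phi]/(phiL : _ -> _) linearN opprK /= phi_lie.
exists c => x y; have := congr1 (fun f : 'End(g) => killing (f x) y) phi_c.
rewrite !lfunE /= phiE => ->.
by rewrite id_lfunE [LHS](bilZl killing_bilinear).
Qed.

End InvariantForms.

(** * The Casimir operator *)

Section Casimir.
Variables (F : fieldType) (g : finLieAlgType F).
Hypotheses (g_simple : simple_lie g) (g_central : central_lie g).
Hypothesis charF0 : [pchar F] =i pred0.
Local Notation e_ := (@lie_basis F g).
Local Notation d_ := (@dual_basis F g).

Definition casimir (X : lmodType F) (act : g -> X -> X) v :=
  \sum_i act (e_ i) (act (d_ i) v).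

Section Module.
Variables (X : lmodType F) (act : g -> X -> X).
Hypothesis act_mod : lie_module act.

Lemma casimir_linear : linear (casimir act).
Proof.
move=> c x y; rewrite /casimir scaler_sumr -big_split; apply: eq_bigr => i _ /=.
by rewrite !(bilDr act_mod.1, bilZr act_mod.1).
Qed.

(** The sum of the [e_ i (x) d_ i] is invariant: expand [[x, e_ i]] in the [e_ j] and [[x, d_ i]] in
    the [d_ j]; invariance of the Killing form makes the coefficients cancel. *)
Lemma casimir_comm x v : act x (casimir act v) = casimir act (act x v).
Proof.
rewrite /casimir (big_morph (act x) (bilDr act_mod.1 x) (bil0r act_mod.1 x)).
pose f a b := act a (act b v).
have f_suml (c : 'I_(\dim {:g}) -> F) (u : 'I_(\dim {:g}) -> g) b :
    f (\sum_j c j *: u j) b = \sum_j c j *: f (u j) b.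
  rewrite /f (big_morph (act^~ _) (bilDl act_mod.1 _) (bil0l act_mod.1 _)).
  by apply: eq_bigr => j _; rewrite (bilZl act_mod.1).
have f_sumr (c : 'I_(\dim {:g}) -> F) (u : 'I_(\dim {:g}) -> g) a :
    f a (\sum_j c j *: u j) = \sum_j c j *: f a (u j).
  rewrite /f (big_morph (act^~ _) (bilDl act_mod.1 _) (bil0l act_mod.1 _)).
  rewrite (big_morph (act _) (bilDr act_mod.1 _) (bil0r act_mod.1 _)).
  by apply: eq_bigr => j _; rewrite (bilZl act_mod.1) (bilZr act_mod.1).
have split i : act x (act (e_ i) (act (d_ i) v)) =
    f (lie x (e_ i)) (d_ i) + f (e_ i) (lie x (d_ i)) + act (e_ i) (act (d_ i) (act x v)).
  by rewrite /f !act_mod.2 (bilBr act_mod.1) addrA !subrK.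
under eq_bigr do rewrite split.
rewrite big_split /= -[RHS]add0r; congr (_ + _); rewrite big_split /=.
under eq_bigr => i _ do rewrite (killing_expand g_simple charF0 (lie x (e_ i))) f_suml.
under [X in _ + X]eq_bigr => i _ do
  rewrite (killing_expand_dual g_simple charF0 (lie x (d_ i))) f_sumr.
rewrite exchange_big -big_split big1 //= => i _; rewrite -big_split big1 //= => j _.
rewrite -scalerDl !killing_invariant // lieC killingC killingNl killingC addNr scale0r //.
Qed.
End Module.

(** The polynomial projects onto the generalised kernel of the Casimir matrix. It is evaluated by an
    explicit sum so that [N = 0] is covered. *)
Lemma casimir_fitting N (rho : g -> 'M[F]_N) : lie_rep_mx rho ->
  exists p : {poly F}, p.[0] = 1 /\ forall x,
    (\sum_(i < size p) p`_i *: (\sum_j rho (d_ j) *m rho (e_ j)) ^+ i) *m rho x = 0.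
Proof.
case: N rho => [|N] rho [rho_lin rhoM].
  by exists 1; rewrite hornerC; split=> // x; rewrite [LHS]flatmx0.
set C := \sum_j _.
pose act x (v : 'rV[F]_N.+1) := v *m rho x.
have act_mod : lie_module act.
  split; last by move=> x y v; rewrite /act rhoM mulmxBr !mulmxA.
  split=> [v c x y|x c v w] /=; first by rewrite /act rho_lin mulmxDr -scalemxAr.
  by rewrite /act mulmxDl -scalemxAl.
have casE v : casimir act v = v *m C.
  by rewrite mulmx_sumr; apply: eq_bigr => i _; rewrite mulmxA.
have commC x : C *m rho x = rho x *m C.
  apply/row_matrixP => i; rewrite !rowE !mulmxA -!casE.
  exact: (casimir_comm act_mod).
have ch_neq0 : char_poly C != 0 by rewrite monic_neq0 ?char_poly_monic.
have [k [r r0 def_ch]] := multiplicity_XsubC (char_poly C) 0.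
rewrite ch_neq0 /= subr0 in r0 def_ch.
(* Taking [k.+1] in place of the multiplicity [k] gives [p.[0] = 1] even when 0 is not a root. *)
have /Bezout_eq1_coprimepP[[u w] /= uw1] : coprimep 'X^(k.+1) r.
  by rewrite coprimep_expl // -['X]subr0 coprimep_sym coprimep_XsubC.
pose p := w * r; exists p.
have def_p : p = 1 - u * 'X^(k.+1) by rewrite -uw1 addrC addKr.
have -> : \sum_(i < size p) p`_i *: C ^+ i = horner_mx C p.
  rewrite -[in RHS](coefK p) poly_def linear_sum /=; apply: eq_bigr => i _.
  by rewrite linearZ /= rmorphXn /= horner_mx_X.
have p0 : p.[0] = 1 by rewrite def_p !hornerE expr0n /= mulr0 subr0.
have pC : horner_mx C (p * 'X^(k.+1)) = 0.
  have -> : p * 'X^(k.+1) = w * 'X * char_poly C.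
    by rewrite def_ch /p exprS; ring.
  by rewrite rmorphM /= Cayley_Hamilton mulr0.
pose e := horner_mx C p.
have ee : e *m e = e.
  apply/eqP; rewrite -subr_eq0 -oppr_eq0 opprB -[e in e - _]mulmx1 -mulmxBr.
  have -> : 1%:M - e = horner_mx C (u * 'X^(k.+1)).
    by rewrite -[u * _](subKr 1) -def_p rmorphB (rmorph1 (horner_mx C)).
  by rewrite -[_ *m _]rmorphM /= mulrCA rmorphM /= pC mulr0.
have commE x : e *m rho x = rho x *m e.
  exact: (comm_horner_mx p (commC x : comm_mx C (rho x))).
have tr_eC : \tr (e *m C) = 0.
  apply: (@nilpotent_mxtrace _ _ _ k.+1).
  have eC : GRing.comm e C by exact: (comm_horner_mx p (erefl : comm_mx C C)).
  rewrite -[e *m C]/(e * C) exprMn_comm // [e ^+ k.+1](_ : _ = e).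
    rewrite (_ : C ^+ k.+1 = horner_mx C 'X^(k.+1)); last by rewrite rmorphXn /= horner_mx_X.
    by rewrite -rmorphM.
  by elim: k {pC uw1 def_p def_ch} => [|k IHk]; rewrite ?expr1 // exprS IHk.
pose rho' x := e *m rho x.
have rho'_rep : lie_rep_mx rho'.
  split=> [c x y|x y]; rewrite /rho'; first by rewrite rho_lin mulmxDr -scalemxAr.
  rewrite rhoM mulmxBr !mulmxA -!(mulmxA e (rho _) e) -!commE !mulmxA ee //.
pose tau x y : F^o := \tr (rho' x *m rho' y).
have tau_bil : bilinear_for *:%R *:%R tau.
  split=> [z c x y|z c x y]; rewrite /tau /= rho'_rep.1.
    by rewrite mulmxDl -scalemxAl mxtraceD mxtraceZ.
  by rewrite mulmxDr -scalemxAr mxtraceD mxtraceZ.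
have [|c tauE] := invariant_form_killing g_simple g_central charF0 tau_bil.
  by move=> x y z; rewrite /tau !rho'_rep.2 mxtrace_commutator.
(* Summed over the dual bases, [tau] gives [c] times the dimension; the same sum is the trace of the
   nilpotent matrix [e *m C]. *)
have c0 : c = 0.
  have : \sum_j tau (d_ j) (e_ j) = 0.
    transitivity (\tr (e *m C)) => //; rewrite mulmx_sumr raddf_sum /=.
    apply: eq_bigr => j _; rewrite /tau /rho' -mulmxA (mulmxA (rho _)) -commE.
    by rewrite !mulmxA ee.
  rewrite (eq_bigr (fun _ => c)) => [|j _]; last first.
    by rewrite tauE killingC killing_dual // eqxx mulr1.
  rewrite sumr_const card_ord -mulr_natr => /eqP; rewrite mulf_eq0 => /orP[/eqP//|].
  rewrite ((pcharf0P F).1 charF0) dimv_eq0 => /eqP g0.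
  have [x [y]] := g_simple.1.
  by have := memvf x; rewrite g0 memv0 => /eqP->; rewrite lie0l eqxx.
split=> // x; apply: (cartan_criterion g_simple charF0 rho'_rep) => y z.
by rewrite -[LHS]/(tau y z) tauE c0 mul0r.
Qed.
End Casimir.

(** [p(f)] for a bare function [f], so that one [p] can be applied on spaces of any dimension and
    compared along equivariant maps by [horner_op_morph]. *)
Definition horner_op (F : fieldType) (X : lmodType F) (p : {poly F}) (f : X -> X) v :=
  \sum_(i < size p) p`_i *: iter i f v.

Section HornerOp.
Variables (F : fieldType).

Lemma iter_linear (X : lmodType F) (f : X -> X) k : linear f -> linear (iter k f).
Proof. by move=> f_lin; elim: k => [|k IHk] c x y //=; rewrite IHk f_lin. Qed.

Lemma horner_op_linear (X : lmodType F) p (f : X -> X) : linear f -> linear (horner_op p f).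
Proof.
move=> f_lin c x y; rewrite /horner_op scaler_sumr -big_split; apply: eq_bigr => i _ /=.
by rewrite iter_linear // scalerDr !scalerA mulrC.
Qed.

Lemma horner_op_morph (X Y : lmodType F) p (f : X -> X) (f' : Y -> Y) (h : X -> Y) v :
  linear h -> (forall x, h (f x) = f' (h x)) -> h (horner_op p f v) = horner_op p f' (h v).
Proof.
move=> h_lin hf; pose hL : {linear X -> Y} := HB.pack h (GRing.isLinear.Build _ _ _ _ _ h_lin).
rewrite -[h]/(hL : _ -> _) linear_sum; apply: eq_bigr => i _; rewrite linearZ /=.
by congr (_ *: _); elim: {i}(i : nat) => //= k <-; rewrite hf.
Qed.

Lemma horner_op_fix (X : lmodType F) p (f : X -> X) v : linear f -> p.[0] = 1 -> f v = 0 ->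
  horner_op p f v = v.
Proof.
move=> f_lin p0 fv; have f0 : f 0 = 0.
  by have := f_lin (-1) 0 0; rewrite !scaleN1r !oppr0 !addr0 addNr.
have p_neq0 : p != 0 by apply: contra_eq_neq p0 => ->; rewrite hornerC eq_sym oner_eq0.
rewrite /horner_op -(prednK (_ : 0 < size p)%N) ?size_poly_gt0 //.
rewrite big_ord_recl -horner_coef0 p0 scale1r big1 ?addr0 // => i _.
rewrite iterSr fv; suff -> : iter i f 0 = 0 by rewrite scaler0.
by elim: (i : nat) => //= k ->.
Qed.
End HornerOp.

Section CasimirVect.
Variables (F : fieldType) (g : finLieAlgType F).
Hypotheses (g_simple : simple_lie g) (g_central : central_lie g).
Hypothesis charF0 : [pchar F] =i pred0.
Local Notation e_ := (@lie_basis F g).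
Local Notation d_ := (@dual_basis F g).
Local Notation n := (\dim {:g}).

Lemma natr_dim_neq0 : (n%:R : F) != 0.
Proof.
rewrite ((pcharf0P F).1 charF0) dimv_eq0; apply/eqP => g0.
have [x [y]] := g_simple.1.
by have := memvf x; rewrite g0 memv0 => /eqP->; rewrite lie0l eqxx.
Qed.

Lemma rep_mx_casimir (E : vectType F) (act : g -> E -> E) v : lie_module act ->
  v2r (casimir act v) = v2r v *m \sum_j rep_mx act (d_ j) *m rep_mx act (e_ j).
Proof.
move=> act_mod; rewrite mulmx_sumr linear_sum; apply: eq_bigr => i _.
by rewrite mulmxA !mul_rep_mx.
Qed.

Lemma casimir_fitting_vect (E : vectType F) (act : g -> E -> E) : lie_module act ->
  exists p : {poly F}, p.[0] = 1 /\
    forall x v, act x (horner_op p (casimir act) v) = 0.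
Proof.
move=> act_mod.
have [p [p0 pP]] := casimir_fitting g_simple g_central charF0 (rep_mx_lie_rep act_mod).
exists p; split=> // x v; apply: (can_inj v2rK); rewrite -mul_rep_mx // linear0.
set C := (\sum_j rep_mx act (d_ j) *m rep_mx act (e_ j)) in pP.
have -> : v2r (horner_op p (casimir act) v) = v2r v *m \sum_(i < size p) p`_i *: C ^+ i.
  rewrite mulmx_sumr linear_sum; apply: eq_bigr => i _.
  rewrite linearZ /= -scalemxAr; congr (_ *: _).
  elim: (i : nat) => [|k IHk]; first by rewrite expr0 mulmx1.
  by rewrite iterS rep_mx_casimir // IHk exprSr mulmxA.
by rewrite -mulmxA pP mulmx0.
Qed.

(** The operator lies in the centroid, so it is a scalar [k]. Its trace is the sum of the
    [killing (d_ j) (e_ j)], that is the dimension, whence [k = 1]. *)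
Lemma casimir_adjoint y : casimir lie y = y :> g.
Proof.
have ad_mod := adjoint_module g.
pose c : {linear g -> g} := HB.pack (casimir (@lie F g))
  (GRing.isLinear.Build _ _ _ _ _ (casimir_linear ad_mod)).
have c_lie (a b : g) : casimir lie (lie a b) = lie a (casimir lie b).
  by rewrite -(casimir_comm g_simple charF0 ad_mod).
have [|k ck] := g_central (f := linfun c).
  move=> a b; rewrite !lfunE /= c_lie; split=> //.
  by rewrite [RHS]lieC -[lie b _]c_lie (lieC b a) [casimir lie (- _)](linearN c) opprK;
    apply/esym/c_lie.
have cE (z : g) : casimir lie z = k *: z.
  have := congr1 (fun f : 'End(g) => f z) ck; rewrite lfunE /= => ->.
  by rewrite scale_lfunE id_lfunE.
suff k1 : k = 1 by rewrite cE k1 scale1r.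
have : \sum_j rep_mx lie (d_ j) *m rep_mx lie (e_ j) = k%:M.
  apply: eq_v2r_mulmx => z.
  by rewrite -rep_mx_casimir // cE linearZ mul_mx_scalar.
move/(congr1 mxtrace); rewrite raddf_sum mxtrace_scalar /=.
under eq_bigr => j _ do rewrite -/(killing _ _) killingC killing_dual // eqxx.
rewrite sumr_const card_ord -dimvf => e; apply: (mulIf natr_dim_neq0).
by rewrite mul1r mulr_natr -e.
Qed.
End CasimirVect.

(** * Linear maps out of the Lie algebra *)

Section HomSpace.
Variables (F : fieldType) (g : finLieAlgType F).
Local Notation n := (\dim {:g}).
Local Notation e_ := (@lie_basis F g).
Local Notation coo := (coord (vbasis {:g})).

Lemma coord_lie_basis i j : coo i (e_ j) = (i == j)%:R.
Proof. by rewrite coord_free ?(basis_free (vbasisP _)) // eq_sym. Qed.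

(* A linear map from [g] to [X] is given by the family of its values on
   [lie_basis]; [hom_eval] recovers the map. *)
Definition hom_eval (X : lmodType F) (s : {ffun 'I_n -> X}) (y : g) : X :=
  \sum_k coo k y *: s k.

Definition hom_comp (X Y : lmodType F) (h : X -> Y) (s : {ffun 'I_n -> X}) :
  {ffun 'I_n -> Y} := [ffun k => h (s k)].

Definition hom_act (X : lmodType F) (act : g -> X -> X) x (s : {ffun 'I_n -> X}) :=
  [ffun k => act x (s k) - hom_eval s (lie x (e_ k))].

Definition hom_delta (X : lmodType F) k (v : X) : {ffun 'I_n -> X} :=
  [ffun j => (j == k)%:R *: v].

Section Eval.
Variable (X : lmodType F).
Implicit Types s t : {ffun 'I_n -> X}.

Lemma hom_eval_bilinear : bilinear_for *:%R *:%R (@hom_eval X).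
Proof.
split=> [y c s t|s c y z] /=; rewrite /hom_eval scaler_sumr -big_split;
  apply: eq_bigr => k _ /=.
  by rewrite !ffunE scalerDr !scalerA mulrC.
by rewrite linearP scalerDl scalerA.
Qed.

Lemma hom_eval_basis s k : hom_eval s (e_ k) = s k.
Proof.
rewrite /hom_eval (bigD1 k) //= coord_lie_basis eqxx scale1r big1 ?addr0 // => j /negPf jk.
by rewrite coord_lie_basis jk scale0r.
Qed.

Lemma eq_hom_eval s t : hom_eval s =1 hom_eval t -> s = t.
Proof. by move=> st; apply/ffunP => k; rewrite -!hom_eval_basis. Qed.

Lemma hom_delta_sum s : s = \sum_k hom_delta k (s k).
Proof.
apply/ffunP => j; rewrite sum_ffunE (bigD1 j) //= ffunE eqxx scale1r big1 ?addr0 //.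
by move=> k /negPf kj; rewrite ffunE eq_sym kj scale0r.
Qed.

Lemma hom_delta_linear k : linear (@hom_delta X k).
Proof.
by move=> c u v; apply/ffunP => j; rewrite !ffunE scalerDr !scalerA mulrC.
Qed.
End Eval.

Lemma linear_hom_eval (X : lmodType F) (h : g -> X) y :
  linear h -> hom_eval [ffun k => h (e_ k)] y = h y.
Proof.
move=> h_lin; pose hL : {linear g -> X} := HB.pack h (GRing.isLinear.Build _ _ _ _ _ h_lin).
rewrite {2}(lie_basis_coord y) -[h]/(hL : _ -> _) linear_sum.
by apply: eq_bigr => k _; rewrite ffunE linearZ.
Qed.

Section Comp.
Variables (X Y : lmodType F) (h : X -> Y).
Hypothesis h_lin : linear h.

Lemma hom_comp_linear : linear (hom_comp h).
Proof. by move=> c s t; apply/ffunP => k; rewrite !ffunE h_lin. Qed.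

Lemma hom_eval_comp s y : hom_eval (hom_comp h s) y = h (hom_eval s y).
Proof.
pose hL : {linear X -> Y} := HB.pack h (GRing.isLinear.Build _ _ _ _ _ h_lin).
rewrite -[h]/(hL : _ -> _) [in RHS]linear_sum; apply: eq_bigr => k _.
by rewrite linearZ ffunE.
Qed.

Lemma hom_comp_delta k v : hom_comp h (hom_delta k v) = hom_delta k (h v).
Proof.
pose hL : {linear X -> Y} := HB.pack h (GRing.isLinear.Build _ _ _ _ _ h_lin).
by apply/ffunP => j; rewrite !ffunE -[h]/(hL : _ -> _) linearZ.
Qed.

Variables (actX : g -> X -> X) (actY : g -> Y -> Y).
Hypothesis h_equiv : forall x v, h (actX x v) = actY x (h v).

Lemma hom_comp_act x s : hom_comp h (hom_act actX x s) = hom_act actY x (hom_comp h s).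
Proof.
pose hL : {linear X -> Y} := HB.pack h (GRing.isLinear.Build _ _ _ _ _ h_lin).
apply/ffunP => k; rewrite !ffunE hom_eval_comp -h_equiv.
by rewrite -[h]/(hL : _ -> _) linearB.
Qed.

Lemma hom_comp_horner p s :
  hom_comp h (horner_op p (casimir (hom_act actX)) s) =
  horner_op p (casimir (hom_act actY)) (hom_comp h s).
Proof.
apply: horner_op_morph; first exact: hom_comp_linear.
pose hL : {linear {ffun 'I_n -> X} -> {ffun 'I_n -> Y}} :=
  HB.pack (hom_comp h) (GRing.isLinear.Build _ _ _ _ _ hom_comp_linear).
move=> t; rewrite -[hom_comp h]/(hL : _ -> _) linear_sum; apply: eq_bigr => i _.
by rewrite /= !hom_comp_act.
Qed.
End Comp.

Section Act.
Variables (X : lmodType F) (act : g -> X -> X).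
Hypothesis act_mod : lie_module act.

Lemma hom_eval_act x s y :
  hom_eval (hom_act act x s) y = act x (hom_eval s y) - hom_eval s (lie x y).
Proof.
pose h y := act x (hom_eval s y) - hom_eval s (lie x y).
have h_lin : linear h.
  move=> c u v; rewrite /h lieDr lieZr !(bilDr (hom_eval_bilinear X)).
  rewrite !(bilZr (hom_eval_bilinear X)) (bilDr act_mod.1) (bilZr act_mod.1).
  by rewrite opprD addrACA -scalerBr.
rewrite -[RHS](linear_hom_eval y h_lin). rewrite /hom_eval; apply: eq_bigr => k _.
by congr (_ *: _); rewrite !ffunE /h hom_eval_basis.
Qed.

Lemma hom_act_module : lie_module (hom_act act).
Proof.
have evb := hom_eval_bilinear X.
split; first split=> [s c x y|x c s t] /=; last 1 first.
- move=> x y s; apply: eq_hom_eval => z.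
  rewrite (bilBl evb) !hom_eval_act act_mod.2 lie_lie !(bilBr act_mod.1) (bilBr evb) !opprB.
  set P := act x (act y _); set Q := act y (act x _); set R := act x _.
  set S := act y _; set T := hom_eval s (lie x _); set U := hom_eval s (lie y _).
  by rewrite [RHS]addrACA !subrKA addrACA [RHS]addrACA (addrC (- Q)).
- apply: eq_hom_eval => z; rewrite (bilDl evb) (bilZl evb) !hom_eval_act lieDl lieZl.
  rewrite (bilDl act_mod.1) (bilZl act_mod.1) (bilDr evb) (bilZr evb).
  by rewrite opprD addrACA -scalerBr.
- apply: eq_hom_eval => z; rewrite (bilDl evb) (bilZl evb) !hom_eval_act.
  by rewrite !(bilDl evb, bilZl evb, bilDr act_mod.1, bilZr act_mod.1) opprD addrACA -scalerBr.
Qed.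
End Act.
End HomSpace.

(** * The projection of the endomorphisms of [g] onto the scalars *)

Section TraceProjection.
Variables (F : fieldType) (g : finLieAlgType F).
Hypotheses (g_simple : simple_lie g) (g_central : central_lie g).
Hypothesis charF0 : [pchar F] =i pred0.
Local Notation n := (\dim {:g}).
Local Notation e_ := (@lie_basis F g).
Local Notation coo := (coord (vbasis {:g})).

Definition hom_trace (s : {ffun 'I_n -> g}) : F := \sum_k coo k (s k).

Lemma hom_trace_linear : linear (hom_trace : _ -> F^o).
Proof.
move=> c s t; rewrite /hom_trace [X in _ = X + _]mulr_sumr -big_split; apply: eq_bigr => k _.
by rewrite !ffunE linearP.
Qed.

Lemma hom_trace_act x s : hom_trace (hom_act lie x s) = 0.
Proof.
rewrite /hom_trace; under eq_bigr => k _ do rewrite ffunE linearB.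
rewrite sumrB; apply/eqP; rewrite subr_eq0; apply/eqP.
have lie_sumr (c : 'I_n -> F) : lie x (\sum_j c j *: e_ j) = \sum_j c j *: lie x (e_ j).
  rewrite (big_morph (lie x) (fun u v => lieDr u v x) (lie0r x)).
  by apply: eq_bigr => j _; rewrite lieZr.
under eq_bigr => k _ do rewrite (lie_basis_coord (s k)) lie_sumr linear_sum.
rewrite exchange_big; apply: eq_bigr => k _ /=.
rewrite linear_sum; apply: eq_bigr => j _.
by rewrite linearZ [RHS]linearZ; apply: mulrC.
Qed.

Lemma hom_trace_delta k y : hom_trace (hom_delta k y) = coo k y.
Proof.
rewrite /hom_trace (bigD1 k) //= ffunE eqxx scale1r big1 ?addr0 // => j /negPf jk.
by rewrite ffunE jk scale0r linear0.
Qed.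

Lemma hom_invariant_scalar (s : {ffun 'I_n -> g}) :
  (forall x, hom_act lie x s = 0) -> s = [ffun k => (hom_trace s / n%:R) *: e_ k].
Proof.
move=> s_inv.
have ev_lin : linear (hom_eval s).
  by move=> c u v; rewrite (bilDr (hom_eval_bilinear g g)) (bilZr (hom_eval_bilinear g g)).
pose f : {linear g -> g} := HB.pack (hom_eval s) (GRing.isLinear.Build _ _ _ _ _ ev_lin).
have s_lie x y : lie x (hom_eval s y) = hom_eval s (lie x y).
  apply/eqP; rewrite -subr_eq0 -(hom_eval_act (adjoint_module g)) s_inv.
  by rewrite (bil0l (hom_eval_bilinear g g)).
have [|c fc] := g_central (f := linfun f).
  move=> a b; rewrite !lfunE /= s_lie; split=> //.
  by rewrite [RHS]lieC s_lie (lieC b a) (bilNr (hom_eval_bilinear g g)) opprK.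
have sE k : s k = c *: e_ k.
  rewrite -hom_eval_basis; have := congr1 (fun h : 'End(g) => h (e_ k)) fc.
  by rewrite lfunE /= => ->; rewrite scale_lfunE id_lfunE.
have -> : hom_trace s = c * n%:R.
  rewrite /hom_trace; under eq_bigr => k _ do rewrite sE linearZ /= coord_lie_basis eqxx mulr1.
  by rewrite sumr_const card_ord mulr_natr.
by apply/ffunP => k; rewrite ffunE mulfK ?natr_dim_neq0.
Qed.

(** The trace kills the image of the Casimir operator and [p.[0] = 1], so [p] of that operator
    preserves traces. Its values are invariant, hence scalar, and a scalar is determined by its
    trace. *)
Lemma trace_projection : exists p : {poly F}, p.[0] = 1 /\
  forall s : {ffun 'I_n -> g}, horner_op p (casimir (hom_act lie)) s =
    [ffun k => (hom_trace s / n%:R) *: e_ k].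
Proof.
have act_mod := hom_act_module (adjoint_module g).
have [p [p0 pP]] := casimir_fitting_vect g_simple g_central charF0 act_mod.
exists p; split=> // s; rewrite [LHS]hom_invariant_scalar //.
suff -> : hom_trace (horner_op p (casimir (hom_act lie)) s) = hom_trace s by [].
have tr_cas t : hom_trace (casimir (hom_act lie) t) = 0.
  pose tr : {linear {ffun 'I_n -> g} -> F^o} :=
    HB.pack (hom_trace : _ -> F^o)
      (GRing.isLinear.Build F {ffun 'I_n -> g} F^o *:%R _ hom_trace_linear).
  rewrite -[hom_trace]/(tr : _ -> _) linear_sum big1 // => i _.
  exact: hom_trace_act.
rewrite (@horner_op_morph _ _ F^o _ _ (fun=> 0) _ _ hom_trace_linear) //.
by apply: (@horner_op_fix F F^o p (fun=> 0)) => // c u v; rewrite scaler0 addr0.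
Qed.
End TraceProjection.

(** * Square-zero extensions *)

Section FixedPoints.
Variables (F : fieldType) (U : lmodType F) (e : {linear U -> U}).

Definition fixed_by : {pred U} := [pred x | e x == x].

Fact fixed_by_submod : submod_closed fixed_by.
Proof.
split=> [|c x y]; rewrite !inE ?linear0 // => /eqP ex /eqP ey.
by rewrite linearP ex ey.
Qed.
HB.instance Definition _ := GRing.isSubmodClosed.Build F U fixed_by fixed_by_submod.

(** Used for an idempotent [e]: its image then stands for the quotient [V / A], realised as a
    complement. *)
Record fixed_points := FixedPoints {fixed_val : U; _ : fixed_val \in fixed_by}.
HB.instance Definition _ := [isSub for fixed_val].
HB.instance Definition _ := [Choice of fixed_points by <:].
HB.instance Definition _ := [SubChoice_isSubLmodule of fixed_points by <:].
End FixedPoints.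

Definition module_action (F : fieldType) (A : comAlgType F) (W : lmodType F)
    (m : A -> W -> W) :=
  [/\ bilinear_for *:%R *:%R m, forall w, m 1 w = w &
      forall a b w, m (a * b) w = m a (m b w)].

(** The proof [m_act] is a parameter of the type so that the ring structure can depend on the action
    and differs from the componentwise one on pairs. *)
Definition square_zero (F : fieldType) (A : comAlgType F) (W : lmodType F)
  (m : A -> W -> W) (m_act : module_action m) : Type := (A * W)%type.

Section SquareZero.
Variables (F : fieldType) (A : comAlgType F) (W : lmodType F).
Variables (m : A -> W -> W) (m_act : module_action m).
Local Notation T := (square_zero m_act).

HB.instance Definition _ := GRing.Lmodule.copy T (A * W)%type.

Let one : T := (1, 0).
Let mul (x y : T) : T := (x.1 * y.1, m x.1 y.2 + m y.1 x.2).

Let m_bil : bilinear_for *:%R *:%R m. Proof. by case: m_act. Qed.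
Let m1 w : m 1 w = w. Proof. by case: m_act. Qed.
Let mM a b w : m (a * b) w = m a (m b w). Proof. by case: m_act. Qed.

Let mulA : associative mul.
Proof.
move=> [a u] [b v] [c w]; congr pair => /=; first exact: mulrA.
rewrite !(bilDr m_bil) -!mM addrA; congr (_ + m _ _ + m _ _); last exact: mulrC.
exact: mulrC.
Qed.
Let mulC : commutative mul.
Proof. by move=> [a u] [b v]; rewrite /mul /= mulrC addrC. Qed.
Let mul1 : left_id one mul.
Proof. by move=> [a u]; rewrite /mul /= mul1r m1 (bil0r m_bil) addr0. Qed.
Let mulDl : left_distributive mul +%R.
Proof.
move=> [a u] [b v] [c w]; congr pair => /=; first exact: mulrDl.
by rewrite (bilDl m_bil) (bilDr m_bil) addrACA.
Qed.
Let one_neq0 : one != 0.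
Proof. by apply/eqP => -[/eqP]; rewrite oner_eq0. Qed.

HB.instance Definition _ := GRing.Zmodule_isComNzRing.Build T mulA mulC mul1 mulDl one_neq0.

Let scaleAl (c : F) (x y : T) : c *: (x * y) = (c *: x) * y.
Proof.
case: x y => [a u] [b v]; congr pair => /=; first exact: scalerAl.
by rewrite (bilZl m_bil) (bilZr m_bil) scalerDr.
Qed.

HB.instance Definition _ := GRing.Lmodule_isLalgebra.Build F T scaleAl.
HB.instance Definition _ := GRing.Lalgebra_isComAlgebra.Build F T.

Definition square_zero_incl (a : A) : T := (a, 0).

Let incl_linear : linear square_zero_incl.
Proof. by move=> c a b; congr pair; rewrite /= scaler0 addr0. Qed.
Let incl_monoid : monoid_morphism square_zero_incl.
Proof. by split=> // a b; congr pair; rewrite /= !(bil0r m_bil) addr0. Qed.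
HB.instance Definition _ := GRing.isLinear.Build F A T *:%R square_zero_incl incl_linear.
HB.instance Definition _ := GRing.isMonoidMorphism.Build A T square_zero_incl incl_monoid.
End SquareZero.

(** * Coisotropic current algebras *)

Section Coisotropic.
Variables (F : fieldType) (charF0 : [pchar F] =i pred0).
Variables (g : finLieAlgType F) (g_simple : simple_lie g) (g_central : central_lie g).
Variables (A : comAlgType F) (L : lieAlgType F) (B : {biscalar L}).
Hypothesis B_inv : form_invariant B.
Variable iota : {linear tensor g A -> L}.
Hypothesis iota_lie : forall s t : tensor g A, iota (lie s t) = lie (iota s) (iota t).
Hypothesis gA_coisotropic : coisotropic B (range iota).

Local Notation n := (\dim {:g}).
Local Notation e_ := (@lie_basis F g).
Local Notation d_ := (@dual_basis F g).
Local Notation coo := (coord (vbasis {:g})).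
Local Notation Y := {ffun 'I_n -> L}.

Definition current (y : g) (a : A) : L := iota (tens y a).

Lemma current_bilinear : bilinear_for *:%R *:%R current.
Proof.
by split=> [a c x y|x c a b]; rewrite /current /= ?tensDl ?tensDr ?tensZl ?tensZr linearP.
Qed.

Lemma lie_current x y a b : lie (current x a) (current y b) = current (lie x y) (a * b).
Proof. by rewrite /current -iota_lie lie_tens. Qed.

Definition act (x : g) (l : L) : L := lie (current x 1) l.

Lemma act_module : lie_module act.
Proof.
split; last by move=> x y v; rewrite /act -[1 in LHS]mulr1 -lie_current lie_lie.
split=> [l c x y|x c l l'] /=; rewrite /act; last by rewrite lieDr lieZr.
by rewrite (bilDl current_bilinear) (bilZl current_bilinear) lieDl lieZl.
Qed.

Lemma current_act a x y : current (lie x y) a = act x (current y a).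
Proof. by rewrite /act lie_current mul1r. Qed.

Lemma form_bilinear : bilinear_for *:%R *:%R (B : L -> L -> F^o).
Proof.
split=> [z c x y|z c x y] /=.
  by rewrite linearDl linearZl_LR.
by rewrite linearDr linearZr_LR.
Qed.

(* The pairing of [l] with [g (x) a], read as an element of [g] through the
   Killing form. *)
Definition beta (a : A) (l : L) : g := \sum_i (B l (current (e_ i) a) : F) *: d_ i.

Lemma killing_beta a l z : killing (beta a l) z = B l (current z a).
Proof.
rewrite [LHS](bilinear_suml _ _ _ (killing_bilinear g)).
pose f y : F^o := B l (current y a); have f_lin : linear f.
  move=> c x y; rewrite /f (bilDl current_bilinear) (bilZl current_bilinear).
  by rewrite [LHS](bilDr form_bilinear) (bilZr form_bilinear).
pose fL : {linear g -> F^o} := HB.pack f (GRing.isLinear.Build F g F^o *:%R f f_lin).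
rewrite -[RHS]/(fL z) {2}(killing_expand g_simple charF0 z) linear_sum.
by apply: eq_bigr => i _; rewrite linearZ [LHS]mulrC killingC.
Qed.

Lemma beta_linear a : linear (beta a).
Proof.
move=> c l l'; rewrite /beta scaler_sumr -big_split; apply: eq_bigr => i _ /=.
by rewrite [B _ _](bilDl form_bilinear) (bilZl form_bilinear) scalerDl scalerA.
Qed.

Lemma eq_killing x y : (forall z, killing x z = killing y z) -> x = y :> g.
Proof.
move=> xy; apply/eqP; rewrite -subr_eq0; apply/eqP/(killing_nondegenerate g_simple charF0).
by move=> z; rewrite [LHS](bilBl (killing_bilinear g)) [X in X - _]xy subrr.
Qed.

(** Seen through [beta], bracketing with [x (x) a] acts by [x] on [g] and by [a] on the dual of [A].
    The [A]-action on invariants is read off from this. *)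
Lemma beta_lie a b x l : beta b (lie (current x a) l) = lie x (beta (a * b) l).
Proof.
apply: eq_killing => z; rewrite killing_beta lieC [LHS](bilNl form_bilinear).
by rewrite B_inv lie_current -killing_beta [in RHS]lieC killingNl killing_invariant.
Qed.

Lemma beta_act b x l : beta b (act x l) = lie x (beta b l).
Proof. by rewrite beta_lie mul1r. Qed.

(** The condition says that [l] is orthogonal to [g (x) A]; coisotropy enters here. *)
Lemma beta_eq0 l : (forall a, beta a l = 0) -> exists t, l = iota t.
Proof.
move=> l0; have [|t _ <-] := gA_coisotropic (t := l); last by exists t.
move=> _ [t _ <-]; elim/(@tensor_ind F g A): t => [|s t Hs Ht|z a].
- by rewrite linear0 [LHS](bil0r form_bilinear).
- by rewrite linearD [LHS](bilDr form_bilinear) [X in X + _]Hs [X in _ + X]Ht addr0.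
- by rewrite -/(current z a) -killing_beta l0 [LHS](bil0l (killing_bilinear g)).
Qed.

(** * Invariant linear maps from [g] to [L] *)

Variable p : {poly F}.
Hypothesis p0 : p.[0] = 1.
Hypothesis p_proj : forall s : {ffun 'I_n -> g},
  horner_op p (casimir (hom_act lie)) s = [ffun k => (hom_trace s / n%:R) *: e_ k].

Definition proj0 (s : Y) : Y := horner_op p (casimir (hom_act act)) s.
Definition proj (s : Y) : Y := proj0 (proj0 s).
Definition invariant (s : Y) := forall x, hom_act act x s = 0.

Lemma hom_act_act_module : lie_module (hom_act act : g -> Y -> Y).
Proof. exact: hom_act_module act_module. Qed.

Lemma proj0_linear : linear proj0.
Proof. exact/horner_op_linear/casimir_linear/hom_act_act_module. Qed.

Lemma proj_linear : linear proj.
Proof. by move=> c s t; rewrite /proj !proj0_linear. Qed.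

Lemma hom_act_proj0 x s : hom_act act x (proj0 s) = proj0 (hom_act act x s).
Proof.
apply: horner_op_morph => [c t u|t].
  by rewrite (bilDr hom_act_act_module.1) (bilZr hom_act_act_module.1).
exact: casimir_comm hom_act_act_module _ _.
Qed.

Lemma proj0_invariant s : invariant s -> proj0 s = s.
Proof.
move=> s_inv; apply: horner_op_fix => //; first exact/casimir_linear/hom_act_act_module.
by rewrite /casimir big1 // => i _; rewrite s_inv (bil0r hom_act_act_module.1).
Qed.

Lemma proj_invariant s : invariant s -> proj s = s.
Proof. by move=> s_inv; rewrite /proj !proj0_invariant. Qed.

(* Composition with an equivariant map [h : g -> L] turns [proj0] into the
   projection of [End g] onto the scalars. *)
Lemma proj0_comp (h : g -> L) s : linear h -> (forall x y, h (lie x y) = act x (h y)) ->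
  proj0 (hom_comp h s) = [ffun k => (hom_trace s / n%:R) *: h (e_ k)].
Proof.
move=> h_lin h_lie; rewrite /proj0 -(hom_comp_horner h_lin h_lie) p_proj.
pose hL : {linear g -> L} := HB.pack h (GRing.isLinear.Build _ _ _ _ _ h_lin).
by apply/ffunP => k; rewrite !ffunE -[h]/(hL : _ -> _) linearZ.
Qed.

Lemma comp_invariant (h : g -> L) : linear h -> (forall x y, h (lie x y) = act x (h y)) ->
  invariant [ffun k => h (e_ k)].
Proof.
move=> h_lin h_lie x; apply/ffunP => k; rewrite !ffunE -h_lie linear_hom_eval //.
by rewrite subrr.
Qed.

Lemma invariant_linear s t c : invariant s -> invariant t -> invariant (c *: s + t).
Proof.
move=> s_inv t_inv x; rewrite (bilDr hom_act_act_module.1) (bilZr hom_act_act_module.1).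
by rewrite s_inv t_inv scaler0 addr0.
Qed.

Definition cur_hom (a : A) : Y := [ffun k => current (e_ k) a].

Lemma current_linear a : linear (current^~ a).
Proof. by move=> c x y; rewrite (bilDl current_bilinear) (bilZl current_bilinear). Qed.

Lemma cur_hom_linear : linear cur_hom.
Proof.
by move=> c a b; apply/ffunP => k; rewrite !ffunE (bilDr current_bilinear) (bilZr current_bilinear).
Qed.

Lemma cur_hom_invariant a : invariant (cur_hom a).
Proof.
by apply: (@comp_invariant (current^~ a)) => [|x y]; [apply: current_linear|apply: current_act].
Qed.

Lemma hom_eval_cur_hom a y : hom_eval (cur_hom a) y = current y a.
Proof. exact: linear_hom_eval (current_linear a). Qed.

(** On [Hom(g, g (x) A)], which is [End g (x) A], [proj0] is the trace projection on the first
    factor. Elementary maps suffice, and they factor through [current^~ a]. *)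
Lemma proj0_range (t : {ffun 'I_n -> tensor g A}) : exists a, proj0 (hom_comp iota t) = cur_hom a.
Proof.
pose pL : {linear Y -> Y} := HB.pack proj0 (GRing.isLinear.Build _ _ _ _ _ proj0_linear).
pose cur_homL : {linear A -> Y} := HB.pack cur_hom (GRing.isLinear.Build _ _ _ _ _ cur_hom_linear).
have iota_lin : linear iota by move=> c u v; apply: linearP.
pose cL : {linear {ffun 'I_n -> tensor g A} -> Y} :=
  HB.pack (hom_comp iota) (GRing.isLinear.Build _ _ _ _ _ (hom_comp_linear iota_lin)).
pose P t := exists a, pL (cL t) = cur_homL a.
have P0 : P 0 by exists 0; rewrite !linear0.
have PD u v : P u -> P v -> P (u + v).
  by move=> [a ua] [b vb]; exists (a + b); rewrite !linearD ua vb.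
suff: P t by [].
rewrite (hom_delta_sum t); apply: (big_ind P) => // k _.
pose dL : {linear tensor g A -> {ffun 'I_n -> tensor g A}} :=
  HB.pack (hom_delta k) (GRing.isLinear.Build _ _ _ _ _ (@hom_delta_linear F g _ k)).
rewrite -[hom_delta k]/(dL : _ -> _); elim/(@tensor_ind F g A): (t k) => [|u v Pu Pv|y a].
- by rewrite linear0.
- by rewrite linearD; apply: PD.
have -> : dL (tens y a) = hom_comp (tens^~ a) (hom_delta k y).
  by rewrite hom_comp_delta // => c u v; rewrite tensDl tensZl.
exists ((hom_trace (hom_delta k y) / n%:R) *: a) => /=.
have -> : hom_comp iota (hom_comp (tens^~ a) (hom_delta k y)) =
    hom_comp (current^~ a) (hom_delta k y).
  by apply/ffunP => j; rewrite !ffunE.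
rewrite proj0_comp => [||x z]; [|exact: current_linear|exact: current_act].
by apply/ffunP => j; rewrite !ffunE (bilZr current_bilinear).
Qed.

Lemma range_hom_comp (s : Y) : (forall k, exists t, s k = iota t) ->
  exists t, s = hom_comp iota t.
Proof.
by move=> /choice[t tP]; exists [ffun k => t k]; apply/ffunP => k; rewrite !ffunE.
Qed.

Lemma beta_proj0 a s : hom_comp (beta a) (proj0 s) =
  [ffun k => (hom_trace (hom_comp (beta a) s) / n%:R) *: e_ k].
Proof.
rewrite /proj0 (hom_comp_horner (beta_linear a) (actY := lie)) ?p_proj //.
by move=> x l; apply: beta_act.
Qed.

Lemma scalar_invariant (c : F) x : hom_act lie x [ffun k => c *: e_ k] = 0 :> {ffun 'I_n -> g}.
Proof.
apply/ffunP => k; rewrite !ffunE (@linear_hom_eval _ _ _ (fun y => c *: y)) ?lieZr ?subrr //.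
by move=> d u v; rewrite scalerDr !scalerA mulrC.
Qed.

(** Each [beta a] turns [proj0 s] into a scalar endomorphism, which is invariant; so every [beta a]
    kills the values of [x . proj0 s]. *)
Lemma hom_act_proj0_range x s : exists t, hom_act act x (proj0 s) = hom_comp iota t.
Proof.
apply: range_hom_comp => k; apply: beta_eq0 => a.
have := hom_comp_act (beta_linear a) (fun x l => beta_act a x l) x (proj0 s).
by rewrite beta_proj0 scalar_invariant => /ffunP/(_ k); rewrite !ffunE.
Qed.

(** [y . proj s] is [proj0] of a map into [g (x) A], hence some [cur_hom a], which is invariant. So
    products of two actions kill [proj s], brackets do as well, and [g] is perfect. *)
Lemma proj_is_invariant s : invariant (proj s).
Proof.
have act0 x y : hom_act act x (hom_act act y (proj s)) = 0.
  rewrite /proj (hom_act_proj0 y (proj0 s)); have [t ->] := hom_act_proj0_range y s.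
  by have [a ->] := proj0_range t; apply: cur_hom_invariant.
have f_lin : linear (fun x => hom_act act x (proj s)).
  by move=> c x y; rewrite (bilDl hom_act_act_module.1) (bilZl hom_act_act_module.1).
pose f : {linear g -> Y} := HB.pack (fun x => hom_act act x (proj s))
  (GRing.isLinear.Build _ _ _ _ _ f_lin).
apply: (simple_perfect g_simple (f := f)) => x y /=.
by rewrite hom_act_act_module.2 !act0 subrr.
Qed.

Lemma invariant_eval s x y : invariant s -> hom_eval s (lie x y) = act x (hom_eval s y).
Proof.
move=> s_inv; apply/esym/eqP; rewrite -subr_eq0 -(hom_eval_act act_module) s_inv.
by rewrite (bil0l (hom_eval_bilinear g L)).
Qed.

(* The functional [d_s] of [A] attached to an invariant [s]: [beta b] sends
   [s y] to [d_s b *: y]. *)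
Definition dual_fun (s : Y) (b : A) : F := hom_trace (hom_comp (beta b) s) / n%:R.

Lemma beta_invariant s b : invariant s ->
  hom_comp (beta b) s = [ffun k => dual_fun s b *: e_ k].
Proof. by move=> s_inv; rewrite -{1}(proj0_invariant s_inv) beta_proj0. Qed.

Lemma dual_fun_scalar s b c : hom_comp (beta b) s = [ffun k => c *: e_ k] -> dual_fun s b = c.
Proof.
rewrite /dual_fun => ->; rewrite /hom_trace.
under eq_bigr => k _ do rewrite ffunE linearZ /= coord_lie_basis eqxx mulr1.
by rewrite sumr_const card_ord -[c *+ _]mulr_natr mulfK ?natr_dim_neq0.
Qed.

(** An invariant is thus determined modulo [cur_hom A] by its functional: when that vanishes, [s]
    has values in [g (x) A], and [proj0], which fixes [s], lands in [cur_hom A]. *)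
Lemma dual_fun_eq0 s : invariant s -> (forall b, dual_fun s b = 0) -> exists a, s = cur_hom a.
Proof.
move=> s_inv s0; have [t def_s] : exists t, s = hom_comp iota t.
  apply: range_hom_comp => k; apply: beta_eq0 => b.
  have := beta_invariant b s_inv => /ffunP/(_ k).
  by rewrite !ffunE s0 scale0r.
by rewrite -(proj0_invariant s_inv) def_s; apply: proj0_range.
Qed.

Lemma dual_fun_proj0 s b : dual_fun (proj0 s) b = dual_fun s b.
Proof. exact/dual_fun_scalar/beta_proj0. Qed.

Lemma dual_fun_proj s b : dual_fun (proj s) b = dual_fun s b.
Proof. by rewrite /proj !dual_fun_proj0. Qed.

(** The Casimir operator of [g] is the identity, so [y] is the sum of the [[e_ i, [d_ i, y]]];
    putting [a] on [e_ i] and [s] on [[d_ i, y]] multiplies [s] by [a]. Applying [proj] yields an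
    invariant whatever [s] is, without changing the functional. *)
Definition pre_action (a : A) (s : Y) : Y :=
  proj [ffun k => \sum_i lie (current (e_ i) a) (hom_eval s (lie (d_ i) (e_ k)))].

Lemma pre_action_bilinear : bilinear_for *:%R *:%R pre_action.
Proof.
split=> [s c a b|a c s t] /=; rewrite /pre_action -proj_linear; congr proj;
  apply/ffunP => k; rewrite !ffunE scaler_sumr -big_split; apply: eq_bigr => i _ /=.
  by rewrite (bilDr current_bilinear) (bilZr current_bilinear) lieDl lieZl.
by rewrite (bilDl (hom_eval_bilinear g L)) (bilZl (hom_eval_bilinear g L)) lieDr lieZr.
Qed.

Lemma pre_action_invariant a s : invariant (pre_action a s).
Proof. exact: proj_is_invariant. Qed.

Lemma dual_fun_pre_action a s b : invariant s ->
  dual_fun (pre_action a s) b = dual_fun s (a * b).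
Proof.
move=> s_inv; rewrite dual_fun_proj; apply: dual_fun_scalar; apply/ffunP => k.
pose bL : {linear L -> g} := HB.pack (beta b) (GRing.isLinear.Build _ _ _ _ _ (beta_linear b)).
rewrite !ffunE -[beta b]/(bL : _ -> _) linear_sum.
rewrite -[in RHS](casimir_adjoint g_simple g_central charF0 (e_ k)) scaler_sumr.
apply: eq_bigr => i _; rewrite /= beta_lie -lieZr; congr lie.
rewrite -(hom_eval_comp (beta_linear (a * b))) beta_invariant //.
rewrite (@linear_hom_eval _ _ _ (fun y => dual_fun s (a * b) *: y)) //.
by move=> c u v; rewrite scalerDr !scalerA mulrC.
Qed.

Lemma pre_action_cur_hom a c : pre_action a (cur_hom c) = cur_hom (a * c).
Proof.
rewrite -[RHS](proj_invariant (@cur_hom_invariant _)); congr proj; apply/ffunP => k.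
rewrite !ffunE -{2}(casimir_adjoint g_simple g_central charF0 (e_ k)).
pose cL : {linear g -> L} := HB.pack (current^~ (a * c))
  (GRing.isLinear.Build _ _ _ _ _ (current_linear (a * c))).
rewrite -[current _ (a * c)]/(cL _) linear_sum; apply: eq_bigr => i _.
by rewrite hom_eval_cur_hom lie_current.
Qed.

(** The coordinates of the inverse of the evaluation of invariants on [g]. The factor [n] cancels
    the division by [n] in the trace projection. *)
Definition component k (l : L) : Y := n%:R *: proj (hom_delta k l).

Lemma component_linear k : linear (component k).
Proof.
move=> c u v; rewrite /component hom_delta_linear proj_linear scalerDr !scalerA.
by rewrite mulrC.
Qed.

Lemma component_invariant k l : invariant (component k l).
Proof.
rewrite -[component k l]addr0; apply: invariant_linear; first exact: proj_is_invariant.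
by move=> x; rewrite (bil0r hom_act_act_module.1).
Qed.

Lemma component_eval k j s : invariant s -> component k (s j) = (k == j)%:R *: s.
Proof.
move=> s_inv; have ev_lin : linear (hom_eval s).
  by move=> c u v; rewrite (bilDr (hom_eval_bilinear g L)) (bilZr (hom_eval_bilinear g L)).
rewrite /component -hom_eval_basis -hom_comp_delta // /proj.
rewrite proj0_comp // => [|x y]; last exact: invariant_eval.
rewrite proj0_invariant; last first.
  have -> : [ffun k0 => (hom_trace (hom_delta k (e_ j)) / n%:R) *: hom_eval s (e_ k0)] =
      (hom_trace (hom_delta k (e_ j)) / n%:R) *: s + 0.
    by apply/ffunP => i; rewrite !ffunE hom_eval_basis addr0.
  by apply: invariant_linear => // x; rewrite (bil0r hom_act_act_module.1).
apply/ffunP => i; rewrite !ffunE hom_eval_basis scalerA hom_trace_delta coord_lie_basis.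
by rewrite mulrC mulfVK ?natr_dim_neq0.
Qed.

Lemma component_hom_eval k s y : invariant s -> component k (hom_eval s y) = coo k y *: s.
Proof.
move=> s_inv; pose cL : {linear L -> Y} :=
  HB.pack (component k) (GRing.isLinear.Build _ _ _ _ _ (component_linear k)).
rewrite -[component k]/(cL : _ -> _) linear_sum (bigD1 k) //= big1 => [|j /negPf jk].
  by rewrite addr0 -[component k]/(cL : _ -> _) linearZ /= component_eval // eqxx scale1r.
rewrite -[component k]/(cL : _ -> _) linearZ /= component_eval //.
by rewrite eq_sym jk scale0r scaler0.
Qed.

(** Call the sum [S l]. The map [S] is idempotent and fixes [g (x) A]. No [beta a] separates [l]
    from [S l], so by coisotropy [l - S l] lies in [g (x) A], where [S] both fixes and kills it. *)
Lemma sum_component l : \sum_k (component k l) k = l.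
Proof.
pose S l := \sum_k (component k l) k.
have S_lin : linear S.
  move=> c u v; rewrite /S scaler_sumr -big_split; apply: eq_bigr => k _ /=.
  by rewrite component_linear !ffunE.
pose SL : {linear L -> L} := HB.pack S (GRing.isLinear.Build _ _ _ _ _ S_lin).
pose coL k : {linear L -> Y} :=
  HB.pack (component k) (GRing.isLinear.Build _ _ _ _ _ (component_linear k)).
have component_sum k (v : 'I_n -> Y) : (forall j, invariant (v j)) ->
    component k (\sum_j (v j) j) = v k.
  move=> v_inv; rewrite -[component k]/(coL k : _ -> _) linear_sum /=.
  rewrite (bigD1 k) //= component_eval // eqxx scale1r big1 ?addr0 // => j /negPf jk.
  by rewrite component_eval // eq_sym jk scale0r.
have SS u : S (S u) = S u.
  rewrite {1}/S; apply: eq_bigr => k _; rewrite component_sum // => j.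
  exact: component_invariant.
have S_iota t : S (iota t) = iota t.
  elim/(@tensor_ind F g A): t => [|u v Hu Hv|y a].
  - by rewrite linear0 [LHS](linear0 SL).
  - by rewrite linearD [LHS](linearD SL); congr (_ + _).
  rewrite -/(current y a) -hom_eval_cur_hom.
  have -> : hom_eval (cur_hom a) y = \sum_j (coo j y *: cur_hom a) j.
    by apply: eq_bigr => j _; rewrite [RHS]ffunE.
  apply: eq_bigr => k _; rewrite component_sum // => j.
  rewrite -[_ *: _]addr0; apply: invariant_linear => [|x]; first exact: cur_hom_invariant.
  by rewrite (bil0r hom_act_act_module.1).
(* The [k]-th coordinate of [beta a l] is the trace of [beta a] composed with [hom_delta k l], which
   is also the scalar attached to [component k l]. *)
have [a|t def_t] := @beta_eq0 (l - S l).
  pose bL : {linear L -> g} := HB.pack (beta a) (GRing.isLinear.Build _ _ _ _ _ (beta_linear a)).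
  have -> : beta a (l - S l) = beta a l - beta a (S l) by apply: (linearB bL).
  have -> : beta a (S l) = \sum_k beta a ((component k l) k) by apply: (linear_sum bL).
  apply/eqP; rewrite subr_eq0; apply/eqP.
  rewrite [LHS]lie_basis_coord; apply: eq_bigr => k _.
  have := beta_invariant a (@component_invariant k l) => /ffunP/(_ k).
  rewrite ffunE [RHS]ffunE => ->; congr (_ *: _).
  apply/esym/dual_fun_scalar; apply/ffunP => j.
  have /ffunP/(_ j) := beta_proj0 a (proj0 (hom_delta k l)).
  rewrite -/(dual_fun _ _) dual_fun_proj0 /dual_fun hom_comp_delta; last exact: beta_linear.
  rewrite hom_trace_delta !ffunE => e.
  rewrite -[beta a]/(bL : _ -> _) linearZ /= e scalerA mulrC mulfVK ?natr_dim_neq0 //.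
apply/esym/eqP; rewrite -subr_eq0 -/(S l) def_t -S_iota -def_t.
by rewrite -[S]/(SL : _ -> _) linearB subr_eq0 /= SS.
Qed.

(** * The complement of [A] among the invariants *)

Variable pr : {linear Y -> A}.
Hypothesis pr_cur_hom : cancel cur_hom pr.

(* The projection of [Y] onto a complement of [cur_hom A] among the invariants. *)
Definition compl_proj (s : Y) : Y := proj s - cur_hom (pr (proj s)).

Lemma compl_proj_linear : linear compl_proj.
Proof.
move=> c s t; rewrite /compl_proj proj_linear linearP cur_hom_linear opprD addrACA.
by rewrite -scalerBr.
Qed.
HB.instance Definition _ := GRing.isLinear.Build F Y Y *:%R compl_proj compl_proj_linear.

Let cur_hom0 : cur_hom 0 = 0.
Proof. by have := cur_hom_linear (-1) 0 0; rewrite !scaleN1r !oppr0 !addr0 addNr. Qed.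

Lemma compl_proj_cur_hom a : compl_proj (cur_hom a) = 0.
Proof. by rewrite /compl_proj (proj_invariant (@cur_hom_invariant a)) pr_cur_hom subrr. Qed.

Lemma compl_proj_invariant s : invariant (compl_proj s).
Proof.
rewrite /compl_proj addrC -scaleN1r.
by apply: invariant_linear; [apply: cur_hom_invariant | apply: proj_is_invariant].
Qed.

Lemma compl_proj_of_invariant s : invariant s -> compl_proj s = s - cur_hom (pr s).
Proof. by move=> s_inv; rewrite /compl_proj proj_invariant. Qed.

Lemma pr_compl_proj s : pr (compl_proj s) = 0.
Proof. by rewrite /compl_proj linearB /= pr_cur_hom subrr. Qed.

Lemma compl_proj_idem s : compl_proj (compl_proj s) = compl_proj s.
Proof.
rewrite compl_proj_of_invariant; last exact: compl_proj_invariant.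
by rewrite pr_compl_proj cur_hom0 subr0.
Qed.

(** Reduces the module axioms on the complement to identities between functionals on [A]. *)
Lemma compl_proj_dual_fun s t : invariant s -> invariant t ->
  (forall b, dual_fun s b = dual_fun t b) -> compl_proj s = compl_proj t.
Proof.
move=> s_inv t_inv st; apply/eqP; rewrite -subr_eq0 -linearB /=.
have [||a ->] := @dual_fun_eq0 (s - t); last by rewrite compl_proj_cur_hom.
  by rewrite addrC -scaleN1r; apply: invariant_linear.
move=> b; apply: dual_fun_scalar; apply/ffunP => k.
pose bL : {linear L -> g} := HB.pack (beta b) (GRing.isLinear.Build _ _ _ _ _ (beta_linear b)).
have /ffunP/(_ k) := beta_invariant b s_inv; have /ffunP/(_ k) := beta_invariant b t_inv.
rewrite !ffunE -[beta b]/(bL : _ -> _) linearB /= => -> ->.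
by rewrite st subrr scale0r.
Qed.

Local Notation W := (fixed_points compl_proj).

Let fixedP (w : W) : compl_proj (fixed_val w) = fixed_val w.
Proof. by case: w => s /= /eqP. Qed.

Let fixed_invariant (w : W) : invariant (fixed_val w).
Proof. by rewrite -fixedP; apply: compl_proj_invariant. Qed.

Definition to_compl (s : Y) : W := FixedPoints (introT eqP (compl_proj_idem s)).

Lemma to_compl_linear : linear to_compl.
Proof. by move=> c s t; apply: val_inj; rewrite /= linearP. Qed.

Lemma to_compl_fixed w : to_compl (fixed_val w) = w.
Proof. by apply: val_inj; apply: fixedP. Qed.

Definition compl_action (a : A) (w : W) : W := to_compl (pre_action a (fixed_val w)).

Lemma compl_action_val a w :
  fixed_val (compl_action a w) = compl_proj (pre_action a (fixed_val w)).
Proof. by []. Qed.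

Lemma compl_action_module : module_action compl_action.
Proof.
split.
- split=> [w c a b|a c u v]; rewrite /compl_action /= -to_compl_linear; congr to_compl.
    by rewrite (bilDl pre_action_bilinear) (bilZl pre_action_bilinear).
  by rewrite (bilDr pre_action_bilinear) (bilZr pre_action_bilinear).
- move=> w; rewrite -[RHS]to_compl_fixed; apply: val_inj => /=.
  apply: compl_proj_dual_fun => [||b]; [exact: pre_action_invariant|exact: fixed_invariant|].
  by rewrite dual_fun_pre_action ?mul1r //; apply: fixed_invariant.
move=> a b w; apply: val_inj; set s := fixed_val w.
have s_inv : invariant s := fixed_invariant w.
have bs_inv : invariant (pre_action b s) := @pre_action_invariant b s.
(* The inner projection changes its argument by some [cur_hom c]; multiplication by [a] keeps it in
   [cur_hom A], which the outer projection kills. *)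
have -> : val (compl_action a (compl_action b w)) =
    compl_proj (pre_action a (pre_action b s)).
  rewrite [LHS]compl_action_val compl_action_val (compl_proj_of_invariant bs_inv).
  rewrite (bilBr pre_action_bilinear) pre_action_cur_hom.
  by rewrite [LHS]linearB [X in _ - X = _]compl_proj_cur_hom subr0.
rewrite [LHS]compl_action_val.
apply: compl_proj_dual_fun; [exact: pre_action_invariant|exact: pre_action_invariant|].
by move=> c; rewrite !dual_fun_pre_action // mulrCA mulrA.
Qed.

Local Notation At := (square_zero compl_action_module).

Theorem coisotropic_decomposition :
  exists phi : {linear L -> tensor g At}, bijective phi /\
    forall x l, phi (act x l) = tensor_act x (phi l).
Proof.
have evb := hom_eval_bilinear g L.
pose pt (s : Y) : At := (pr s, to_compl s).
have pt_lin : linear pt by move=> c s t; congr pair; [apply: linearP | apply: to_compl_linear].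
pose ptL : {linear Y -> At} := HB.pack pt (GRing.isLinear.Build _ _ _ _ _ pt_lin).
pose phi l := \sum_k tens (e_ k) (pt (component k l)).
have phi_lin : linear phi.
  move=> c u v; rewrite /phi scaler_sumr -big_split; apply: eq_bigr => k _ /=.
  by rewrite component_linear pt_lin tensDr tensZr.
pose phiL : {linear L -> tensor g At} := HB.pack phi (GRing.isLinear.Build _ _ _ _ _ phi_lin).
(* [(a, w)] in [At] stands for the invariant map [cur_hom a + w]; the inverse of [phi] evaluates it
   at [y]. *)
pose h (y : g) (x : At) : L := hom_eval (cur_hom x.1 + fixed_val x.2) y.
have h_bil : bilinear_for *:%R *:%R h.
  split=> [x c y z|y c x z]; rewrite /h /=; first by rewrite (bilDr evb) (bilZr evb).
  by rewrite cur_hom_linear addrACA -scalerDr (bilDl evb) (bilZl evb).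
pose psiL : {linear tensor g At -> L} :=
  HB.pack (tlift h) (GRing.isLinear.Build _ _ _ _ _ (tlift_linear h_bil)).
have psiE y x : psiL (tens y x) = h y x by apply: tliftE.
have phiK : cancel phiL psiL.
  move=> l; rewrite -[RHS]sum_component linear_sum; apply: eq_bigr => k _.
  rewrite psiE /h /= compl_proj_of_invariant; last exact: component_invariant.
  by rewrite addrC subrK hom_eval_basis.
have psiK : cancel psiL phiL.
  move=> t; elim/(@tensor_ind F g At): t => [|u v Hu Hv|y [a w]].
  - by rewrite !linear0.
  - by rewrite !linearD Hu Hv.
  rewrite psiE /h /=; set v := cur_hom a + _.
  have v_inv : invariant v.
    rewrite /v -[cur_hom a]scale1r.
    by apply: invariant_linear; [apply: cur_hom_invariant|apply: fixed_invariant].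
  have pt_v : pt v = (a, w).
    congr pair; first by rewrite linearD /= pr_cur_hom -fixedP pr_compl_proj addr0.
    by apply: val_inj; rewrite /= linearD /= compl_proj_cur_hom add0r fixedP.
  have tens_lin : linear (fun y : g => tens y ((a, w) : At) : tensor g At).
    by move=> c u u'; rewrite tensDl tensZl.
  rewrite -[RHS](linear_hom_eval y tens_lin).
  apply: eq_bigr => k _; rewrite ffunE component_hom_eval //.
  by rewrite -[pt]/(ptL : _ -> _) linearZ /= pt_v tensZr.
exists phiL; split; first by exists psiL.
move=> x l; rewrite -{1}(phiK l); move: (phiL l) => t.
have act_bil : bilinear_for *:%R *:%R (fun (y : g) (a : At) => tens (lie x y) a).
  by split=> [b c z z'|z c b b'] /=; rewrite ?lieDr ?lieZr ?tensDl ?tensZl ?tensDr ?tensZr.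
pose actL : {linear tensor g At -> tensor g At} :=
  HB.pack (tensor_act (A := At) x) (GRing.isLinear.Build _ _ _ _ _ (tlift_linear act_bil)).
have -> : act x (psiL t) = psiL (actL t).
  elim/(@tensor_ind F g At): t => [|u v Hu Hv|y [a w]].
  - by rewrite !linear0 (bil0r act_module.1).
  - by rewrite !linearD (bilDr act_module.1) Hu Hv.
  rewrite [actL _]tensor_actE !psiE /h /= invariant_eval //.
  rewrite -[cur_hom a]scale1r.
  by apply: invariant_linear; [apply: cur_hom_invariant|apply: fixed_invariant].
by rewrite psiK.
Qed.
End Coisotropic.

Theorem theorem3p2 (F : fieldType) (charF0 : [pchar F] =i pred0)
  (g : finLieAlgType F) (g_simple : simple_lie g) (g_central : central_lie g)
  (A : comAlgType F) (A_reduced : reduced_ring A)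
  (L : lieAlgType F) (B : {biscalar L})
  (B_sym : form_symmetric B) (B_nondeg : form_nondegenerate B)
  (B_inv : form_invariant B)
  (iota : {linear tensor g A -> L})
  (iota_inj : injective iota)
  (iota_lie : forall s t : tensor g A, iota (lie s t) = lie (iota s) (iota t))
  (gA_coisotropic : coisotropic B (range iota)) :
  exists (At : comAlgType F) (j : {lrmorphism A -> At}),
    injective j /\
    exists phi : {linear L -> tensor g At},
      bijective phi /\
      forall (x : g) (l : L),
        phi (lie (iota (tens x 1)) l) = tensor_act x (phi l).
Proof.
have [p [p0 p_proj]] := trace_projection g_simple g_central charF0.
pose cur_homL : {linear A -> {ffun 'I_(\dim {:g}) -> L}} :=
  HB.pack (cur_hom iota) (GRing.isLinear.Build _ _ _ _ _ (cur_hom_linear iota)).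
have cur_hom_inj : injective cur_homL.
  apply: raddf_inj => a cur_a0.
  have n_gt0 : (0 < \dim {:g})%N.
    by rewrite lt0n; apply: contraNneq (natr_dim_neq0 g_simple charF0) => ->.
  pose k := Ordinal n_gt0.
  (* A coordinate form of the nonzero space [g], tensored with the identity of [A], recovers [a]
     from [lie_basis k (x) a]. *)
  have c_bil : bilinear_for *:%R *:%R (fun (y : g) (b : A) => coord (vbasis {:g}) k y *: b).
    split=> [b c x y|x c b b'] /=; first by rewrite linearP scalerDl scalerA.
    by rewrite scalerDr !scalerA mulrC.
  have /iota_inj ta0 : iota (tens (lie_basis k) a) = iota 0.
    by rewrite linear0; have /ffunP/(_ k) := cur_a0; rewrite !ffunE.
  have := tliftE c_bil (lie_basis k) a; rewrite coord_lie_basis eqxx scale1r => <-.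
  pose tL : {linear tensor g A -> A} :=
    HB.pack (tlift (fun (y : g) (b : A) => coord (vbasis {:g}) k y *: b))
      (GRing.isLinear.Build _ _ _ _ _ (tlift_linear c_bil)).
  by rewrite ta0; apply: (linear0 tL).
have [pr pr_cur_hom] := linear_retraction cur_hom_inj.
have pr_cur_hom' : cancel (cur_hom iota) pr := pr_cur_hom.
pose m_act := compl_action_module charF0 g_simple g_central B_inv iota_lie
  gA_coisotropic p0 p_proj pr_cur_hom'.
exists (square_zero m_act), (@square_zero_incl _ _ _ _ m_act).
split; first by move=> a b [].
exact: coisotropic_decomposition.
Qed.
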